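(* Let $d\ge3$ and let $\mathbf{X}$ be a subordinate Brownian motion on $\mathbb{R}^d$ with Lévy–Khintchine exponent $\psi(x)=\varphi(|x|^2)$, where $\varphi$ is a Bernstein function with $\varphi(0)=0$, no drift, and whose Lévy measure $\mu$ has a non-increasing density. The following are equivalent: (i) there exist $\theta\ge0$, $\alpha>0$ and $\overline{c}\ge1$ such that $\varphi'\in\mathrm{WUSC}(-\alpha,\theta,\overline{c})$; (ii) there exist $C>0$ and $\theta>0$ such that for all $t>0$ and $x\in\mathbb{R}^d$ with $t\varphi(|x|^{-2})\le1$ and $0<|x|<\theta^{-1}$, $p(t,x)\ge C\,t|x|^{-d-2}\varphi'(|x|^{-2})$; (iii) there exist $C>0$ and $\theta>0$ such that for $0<|x|<\theta^{-1}$, $\nu(x)\ge C|x|^{-d-2}\varphi'(|x|^{-2})$.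
   Context: A Bernstein function here is $\varphi(u)=\int_{(0,\infty)}(1-e^{-us})\,\mu(\mathrm{d}s)$ with $\int\min\{1,s\}\mu(\mathrm{d}s)<\infty$; it is the Laplace exponent of a subordinator $(T_t)$, and $X_t=B_{T_t}$ with $\mathbf{B}$ an independent Brownian motion on $\mathbb{R}^d$ normalized so that $\mathbb{E}e^{i\langle\xi,X_t\rangle}=e^{-t\varphi(|\xi|^2)}$. Its Lévy measure has the radial non-increasing density $\nu(x)=\int_0^\infty(4\pi s)^{-d/2}e^{-|x|^2/(4s)}\mu(\mathrm{d}s)$, and $p(t,x)$ denotes the density of $X_t$. A function $f$ belongs to $\mathrm{WUSC}(\beta,x_0,C)$ (weak upper scaling at infinity) if $f(\lambda x)\le C\lambda^\beta f(x)$ for all $\lambda\ge1$ and $x>x_0$. *)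

(* Defs.v *)
From HB Require Import structures.
From mathcomp Require Import all_boot all_order all_algebra.
From mathcomp Require Import all_classical all_reals all_analysis.
Set Implicit Arguments. Unset Strict Implicit. Unset Printing Implicit Defensive.
Import Order.TTheory GRing.Theory Num.Theory.
Import numFieldNormedType.Exports.
Local Open Scope classical_set_scope.
Local Open Scope ring_scope.

Section Defs.
Variable R : realType.

(** Euclidean norm on R^d (MathComp's built-in norm on 'rV is the sup norm). *)
Definition enorm (d : nat) (x : 'rV[R]_d) : R :=
  Num.sqrt (\sum_(i < d) x ord0 i ^+ 2).

(** Bernstein function with zero killing, zero drift, and Lévy measure
    mu(ds) = m(s) ds on (0,oo):  phi(u) = int_(0,oo) (1 - e^{-us}) m(s) ds. *)
Definition bern_phi (m : R -> R) (u : R) : R :=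
  fine (\int[@lebesgue_measure R]_(s in `]0, +oo[)
          ((1 - expR (- (u * s))) * m s)%:E).

Definition bern_dphi (m : R -> R) : R -> R := derive1 (bern_phi m).

(** Gaussian kernel with E e^{i<xi,B_s>} = e^{-s|xi|^2}:
    (4 pi s)^{-d/2} exp(-|x|^2/(4s)) *)
Definition gauss (d : nat) (s : R) (x : 'rV[R]_d) : R :=
  (4 * pi * s) `^ (- (d%:R / 2)) * expR (- (enorm x ^+ 2 / (4 * s))).

Definition levy_nu (d : nat) (m : R -> R) (x : 'rV[R]_d) : R :=
  fine (\int[@lebesgue_measure R]_(s in `]0, +oo[) (gauss s x * m s)%:E).

(** transition density of X_t = B_{T_t} at x <> 0, where eta_t is the law
    of the subordinator T_t:  p(t,x) = int_(0,oo) g_s(x) eta_t(ds) *)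
Definition sbm_density (d : nat) (eta : R -> probability R R) (t : R)
    (x : 'rV[R]_d) : R :=
  fine (\int[eta t]_(s in `]0, +oo[) (gauss s x)%:E).

Definition WUSC (f : R -> R) (beta x0 C : R) : Prop :=
  forall lam x, 1 <= lam -> x0 < x -> f (lam * x) <= C * lam `^ beta * f x.

End Defs.

(* Main.v *)
Require Import Defs.
From HB Require Import structures.
From mathcomp Require Import all_boot all_order all_algebra.
From mathcomp Require Import all_classical all_reals all_analysis.
From mathcomp Require Import measurable_realfun ring lra.
Import Order.TTheory GRing.Theory Num.Theory.
Import numFieldNormedType.Exports.
Local Open Scope classical_set_scope.
Local Open Scope ring_scope.

(** Write [u = |x|^-2] and [v = u s].  Both [nu(x)] and [p(t,x)] are
    [|x|^-d] times the integral of one kernel [g(v)], against [m(s) ds] and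
    against the law of [T_t] respectively, and each bound compares this integral
    with [u phi'(u)].

    The weak scaling of [phi'] gives the lower bounds because
    [e^-v - e^-2v] is bounded by a multiple of [g(v)] plus a small multiple of
    the same difference at [v / eps] and at [v / 2]; its integrals are
    [phi(2u) - phi(u)] and [e^(-t phi(u)) - e^(-t phi(2u))], both comparable
    with [u phi'(u)], and monotonicity of [m] yields [phi'(u/2) <= 4 phi'(u)].

    Conversely [g(v) <= C e^-v (1 - e^-v)^2 + g(v/4) / 6].  Rescaling by 4 costs
    a factor 4 for a non-increasing density, so the recursion closes (for the
    law of [T_t] after iterating it and letting [t] tend to 0) and the lower
    bound forces [u phi'(u) <= C Q(u)], where [Q(u)] is the integral of
    [e^-v (1 - e^-v)^2] against [m(s) ds].  As
    [Q(u) <= 2 u (phi'(u/2) - phi'(u))], this says [phi'(2u) <= rho phi'(u)] for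
    some [rho < 1], and iterating gives the scaling. *)

(** * Integration against a nonnegative weight *)

Section weighted_integral.
Context {d : measure_display} {T : measurableType d} {R : realType}.
Variables (mu : {measure set T -> \bar R}) (D : set T) (w : T -> R).
Hypothesis mD : measurable D.

(** Keeping the weight separate lets one integral cover both cases: Lebesgue measure with weight
    [m], and the law of [T_t] with weight 1. *)
Definition wint (f : T -> R) : R := \int[mu]_(s in D) (f s * w s).

Definition wintegrable (f : T -> R) : Prop :=
  mu.-integrable D (EFin \o (fun s => f s * w s)).

Lemma eq_wint f g : (forall s, D s -> f s = g s) -> wint f = wint g.
Proof. by move=> fg; apply: eq_Rintegral => s /[!inE] Ds; rewrite fg. Qed.

Lemma wintegrableB f g : wintegrable f -> wintegrable g ->
  wintegrable (fun s => f s - g s).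
Proof.
move=> wf wg; apply: eq_integrable (integrableB mD wf wg) => // s _ /=.
by rewrite -EFinB -mulrBl.
Qed.

Lemma wintegrableZ c f : wintegrable f -> wintegrable (fun s => c * f s).
Proof.
move=> wf; apply: eq_integrable (integrableZl mD c wf) => // s _ /=.
by rewrite -EFinM mulrA.
Qed.

Lemma wintD f g : wintegrable f -> wintegrable g ->
  wint (fun s => f s + g s) = wint f + wint g.
Proof.
move=> wf wg; rewrite /wint -RintegralD//.
by apply: eq_Rintegral => s _; rewrite mulrDl.
Qed.

Lemma wintB f g : wintegrable f -> wintegrable g ->
  wint (fun s => f s - g s) = wint f - wint g.
Proof.
move=> wf wg; rewrite /wint -RintegralB//.
by apply: eq_Rintegral => s _; rewrite mulrBl.
Qed.

Lemma wintZ c f : wintegrable f -> wint (fun s => c * f s) = c * wint f.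
Proof.
move=> wf; rewrite /wint -RintegralZl//.
by apply: eq_Rintegral => s _; rewrite mulrA.
Qed.

Hypothesis w0 : forall s, D s -> 0 <= w s.

Lemma wint_le f g : wintegrable f -> wintegrable g ->
  (forall s, D s -> f s <= g s) -> wint f <= wint g.
Proof.
move=> wf wg fg; apply: le_Rintegral => // s Ds.
by rewrite ler_wpM2r ?w0 ?fg.
Qed.

Lemma wint_ge0 f : (forall s, D s -> 0 <= f s) -> 0 <= wint f.
Proof.
by move=> f0; apply: Rintegral_ge0 => s Ds; rewrite mulr_ge0 ?w0 ?f0.
Qed.

Hypothesis mw : measurable_fun D w.

Lemma le_wintegrable C (f g : T -> R) : measurable_fun D f -> wintegrable g ->
  (forall s, D s -> `|f s| <= C * g s) -> wintegrable f.
Proof.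
move=> mf wg fg; apply: le_integrable (wintegrableZ C _ wg) => //.
  by apply/measurable_EFinP; exact: measurable_funM.
move=> s Ds /=; rewrite lee_fin !normrM ler_wpM2r//.
by rewrite -normrM (le_trans (fg _ Ds))// ler_norm.
Qed.

End weighted_integral.

(** * Dilations of Lebesgue measure on the half line *)

Section lebesgue_scaling.
Context {R : realType}.
Local Notation mu := (@lebesgue_measure R).

(** The right-hand side is a measure in [A] that agrees with Lebesgue measure on half-open
    intervals, so uniqueness applies. *)
Lemma lebesgue_measure_mulr_preimage (c : R) (A : set R) : 0 < c ->
  measurable A -> mu A = (c%:E * mu ( *%R c @^-1` A))%E.
Proof.
move=> c0.
have mc : measurable_fun [set: measurableTypeR R]
    (( *%R c) : measurableTypeR R -> measurableTypeR R).
  exact: mulrl_measurable.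
pose nu : {measure set (measurableTypeR R) -> \bar R} :=
  mscale (NngNum (ltW c0))
    (pushforward mu ( *%R c : measurableTypeR R -> measurableTypeR R)).
move=> mA; rewrite [RHS](_ : _ = nu mc A)//.
apply: lebesgue_measure_unique mA => _ [[a b] _ <-] /=.
rewrite /nu /mscale/= /pushforward.
have -> : *%R c @^-1` `]a, b]%classic = `]a / c, b / c]%classic.
  apply/seteqP; split => x /=; rewrite !in_itv/= ltr_pdivrMr// ler_pdivlMr//;
    by rewrite (mulrC x).
rewrite !lebesgue_measure_itv/= !lte_fin ltr_pM2r ?invr_gt0//.
case: ifPn => _; last by rewrite mule0.
by rewrite -!EFinB -EFinM -mulrBl mulrC divfK// gt_eqF.
Qed.

Lemma ge0_integral_scale (c : R) (f : R -> \bar R) : 0 < c ->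
  measurable_fun (`]0, +oo[ : set R) f ->
  (forall s, 0 < s -> (0 <= f s)%E) ->
  (\int[mu]_(s in `]0%R, +oo[) f s =
   c%:E * \int[mu]_(s in `]0%R, +oo[) f (c * s)%R)%E.
Proof.
move=> c0 mf f0.
have mc : measurable_fun [set: measurableTypeR R]
    (( *%R c) : measurableTypeR R -> measurableTypeR R).
  exact: mulrl_measurable.
pose p : {measure set (measurableTypeR R) -> \bar R} :=
  pushforward mu ( *%R c : measurableTypeR R -> measurableTypeR R).
have -> : (\int[mu]_(s in `]0%R, +oo[) f s =
    \int[mscale (NngNum (ltW c0)) (p mc)]_(s in `]0%R, +oo[) f s)%E.
  apply: eq_measure_integral => A mA _.
  exact: lebesgue_measure_mulr_preimage.
rewrite ge0_integral_mscale//=; last first.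
  by move=> x; rewrite in_itv/= andbT => /f0.
congr (_ * _)%E; rewrite ge0_integral_pushforward//; last first.
  by move=> x; rewrite inE/= in_itv/= andbT => /f0.
have -> : *%R c @^-1` `]0, +oo[%classic = `]0, +oo[%classic.
  by apply/seteqP; split => x /=; rewrite !in_itv/= !andbT pmulr_rgt0.
by [].
Qed.

End lebesgue_scaling.

(** * Pointwise bounds for the exponential differences *)

Section exponential_kernels.
Context {R : realType}.
Implicit Types v M eps : R.

Definition ediff v : R := expR (- v) - expR (- (2 * v)).

(** A second difference of exponentials. Its coefficients 1, -2, 1 sum to zero, so its integrals
    involve only [phi] at [u], [2u] and [3u]. *)
Definition ediff2 v : R :=
  expR (- v) - 2 * expR (- (2 * v)) + expR (- (3 * v)).

Lemma expRN2 v : expR (- (2 * v)) = expR (- v) ^+ 2.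
Proof. by rewrite -mulrN expRM_natl. Qed.

Lemma expRN3 v : expR (- (3 * v)) = expR (- v) ^+ 3.
Proof. by rewrite -mulrN expRM_natl. Qed.

Lemma ediffE v : ediff v = expR (- v) * (1 - expR (- v)).
Proof. by rewrite /ediff expRN2; ring. Qed.

Lemma ediff2E v : ediff2 v = expR (- v) * (1 - expR (- v)) ^+ 2.
Proof. by rewrite /ediff2 expRN2 expRN3; ring. Qed.

Lemma onem_expRN_le v : 1 - expR (- v) <= v.
Proof. by have := expR_ge1Dx (- v); lra. Qed.

Lemma onem_expRN_ge v : v * expR (- v) <= 1 - expR (- v).
Proof.
have := expR_ge1Dx v; rewrite -(ler_pM2l (expR_gt0 (- v))).
by rewrite -expRD addNr expR0; lra.
Qed.

Lemma onem_expRN_ge0 v : 0 <= v -> 0 <= 1 - expR (- v).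
Proof. by move=> v0; rewrite subr_ge0 expR_le1 oppr_le0. Qed.

Lemma ediff_ge0 v : 0 <= v -> 0 <= ediff v.
Proof. by move=> v0; rewrite ediffE mulr_ge0 ?expR_ge0// onem_expRN_ge0. Qed.

Lemma ediff2_ge0 v : 0 <= ediff2 v.
Proof. by rewrite ediff2E mulr_ge0 ?expR_ge0// sqr_ge0. Qed.

Lemma ediff_le v : ediff v <= v * expR (- v).
Proof. by rewrite ediffE mulrC ler_wpM2r ?expR_ge0// onem_expRN_le. Qed.

Lemma ediff_ge v : v * expR (- (2 * v)) <= ediff v.
Proof.
by rewrite ediffE expRN2 expr2 mulrCA ler_wpM2l ?expR_ge0 ?onem_expRN_ge.
Qed.

Lemma ediff_le1 v : 0 <= v -> ediff v <= 1.
Proof.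
move=> v0; rewrite ediffE mulr_ile1 ?expR_ge0 ?onem_expRN_ge0//.
by rewrite expR_le1 oppr_le0.
Qed.

(** Here [ediff v <= v], while [v / eps <= 1] gives [ediff (v / eps) >= e^-2 v / eps]. *)
Lemma ediff_small eps v : 0 < eps -> 0 <= v -> v <= eps ->
  ediff v <= expR 2 * eps * ediff (v / eps).
Proof.
move=> e0 v0 ve.
apply: (@le_trans _ _ v).
  apply: le_trans (ediff_le v) _.
  by rewrite ler_piMr// expR_le1 oppr_le0.
have := ediff_ge (v / eps).
rewrite -(ler_pM2l (_ : 0 < expR 2 * eps)) ?mulr_gt0 ?expR_gt0//.
apply: le_trans.
set E := expR (- _).
have -> : expR 2 * eps * (v / eps * E) = v * (expR 2 * E).
  by field; rewrite gt_eqF.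
rewrite ler_peMr// -expRD -[leLHS]expR0 ler_expR -[X in X - _]mulr1.
rewrite -mulrBr mulr_ge0//.
by rewrite subr_ge0 ler_pdivrMr// mul1r.
Qed.

(** With [Y = e^(-v/2)], [ediff v] is [(1 + Y) Y] times [ediff (v / 2)], and [Y] is at most
    [e^(-M/2)]. *)
Lemma ediff_large M v : 0 <= v -> M <= v ->
  ediff v <= 2 * expR (- (M / 2)) * ediff (v / 2).
Proof.
move=> v0 Mv; rewrite [leLHS]ediffE.
have -> : expR (- v) = expR (- (v / 2)) ^+ 2.
  by rewrite -expRN2; congr (expR _); field.
rewrite ediffE; set Y := expR (- (v / 2)).
have Y0 : 0 <= Y by exact: expR_ge0.
have Y1 : Y <= 1 by rewrite expR_le1 oppr_le0 divr_ge0.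
have -> : Y ^+ 2 * (1 - Y ^+ 2) = ((1 + Y) * Y) * (Y * (1 - Y)) by ring.
rewrite ler_wpM2r ?mulr_ge0 ?subr_ge0// ler_pM//; first lra.
  by lra.
by rewrite ler_expR; lra.
Qed.

(** With [Y = e^(-v/2)], the left side is at most [Y^2 v^2], and [v/2 Y <= 1 - Y] turns one factor
    [v Y] into a difference. Taken at [v = u s], the right side integrates to an increment of
    [phi']. *)
Lemma ediff2_le v : 0 <= v ->
  ediff2 v <= 2 * v * (expR (- (v / 2)) - expR (- v)).
Proof.
move=> v0; rewrite ediff2E.
have -> : expR (- v) = expR (- (v / 2)) ^+ 2.
  by rewrite -expRN2; congr (expR _); field.
have := onem_expRN_ge (v / 2); have := onem_expRN_ge0 _ v0.
have := onem_expRN_le v.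
have -> : expR (- v) = expR (- (v / 2)) ^+ 2.
  by rewrite -expRN2; congr (expR _); field.
have := expR_ge0 (- (v / 2)).
set Y := expR (- (v / 2)) => Y0 h1 h0 h2.
apply: (@le_trans _ _ (Y ^+ 2 * v ^+ 2)).
  by apply: ler_pM; rewrite ?sqr_ge0// lerXn2r ?nnegrE.
have -> : Y ^+ 2 * v ^+ 2 = 2 * v * Y * (v / 2 * Y) by field.
rewrite (_ : Y - Y ^+ 2 = Y * (1 - Y)); last by ring.
by rewrite [leRHS]mulrA ler_wpM2l// !mulr_ge0.
Qed.

Lemma ediff2_ge v : 0 <= v -> v ^+ 2 * expR (- (3 * v)) <= ediff2 v.
Proof.
move=> v0; rewrite ediff2E expRN3.
have -> : v ^+ 2 * expR (- v) ^+ 3 = expR (- v) * (v * expR (- v)) ^+ 2 by ring.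
rewrite ler_wpM2l ?expR_ge0// lerXn2r ?nnegrE ?mulr_ge0 ?expR_ge0//.
  exact: onem_expRN_ge0.
exact: onem_expRN_ge.
Qed.

End exponential_kernels.

(** * The rescaled Gaussian kernel and its comparison with exponentials *)

Section gaussian_kernel.
Context {R : realType} (d : nat).
Implicit Types v M eps : R.

Definition gker v : R := (4 * pi * v) `^ (- (d%:R / 2)) * expR (- (4 * v)^-1).

Lemma fourpi_ge1 : 1 <= 4 * pi :> R.
Proof. by have := @pi_ge2 R; lra. Qed.

Lemma gker_ge0 v : 0 <= gker v.
Proof. by rewrite mulr_ge0 ?powR_ge0 ?expR_ge0. Qed.

Lemma gker_lower eps M v : 0 < eps -> eps <= v -> v <= M ->
  (4 * pi * M) `^ (- (d%:R / 2)) * expR (- (4 * eps)^-1) <= gker v.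
Proof.
move=> e0 ev vM; have v0 : 0 < v by exact: lt_le_trans ev.
have M0 : 0 < M by exact: lt_le_trans vM.
have p0 : 0 < 4 * pi :> R by have := fourpi_ge1; lra.
rewrite /gker !powRN ler_pM ?invr_ge0 ?powR_ge0 ?expR_ge0//.
  rewrite lef_pV2 ?posrE ?powR_gt0 ?mulr_gt0 ?pi_gt0//.
  apply: ge0_ler_powR; rewrite ?divr_ge0 ?nnegrE//.
  - by rewrite ltW// !mulr_gt0 ?pi_gt0.
  - by rewrite ltW// !mulr_gt0 ?pi_gt0.
  - by rewrite ler_pM2l.
by rewrite ler_expR lerN2 lef_pV2 ?posrE ?mulr_gt0// ler_pM2l.
Qed.

Lemma gker_le1 v : 1 <= v -> gker v <= 1.
Proof.
move=> v1; have := fourpi_ge1 => p1.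
rewrite mulr_ile1 ?powR_ge0 ?expR_ge0//.
  have x1 : 1 <= 4 * pi * v by rewrite -[leLHS]mulr1 ler_pM.
  rewrite powRN invf_le1 ?powR_gt0 ?(lt_le_trans _ x1)//.
  by rewrite -[leLHS](powRr0 (4 * pi * v)) ler_powR ?divr_ge0.
by rewrite expR_le1 oppr_le0 invr_ge0; lra.
Qed.

(** The exponential of [1 / (4v)] dominates its Taylor term of order [n + 1]. *)
Lemma expRN_inv_le (n : nat) v : 0 < v ->
  expR (- (4 * v)^-1) <= n.+1`!%:R * (4 * v) ^+ n.+1.
Proof.
move=> v0; have v40 : 0 < 4 * v by rewrite mulr_gt0.
have := @expR_ge1Dxn R (4 * v)^-1 n; rewrite invr_ge0 (ltW v40) => /(_ isT) h.
rewrite expRN invf_ple ?posrE ?expR_gt0 ?mulr_gt0 ?exprn_gt0 ?ltr0n ?fact_gt0//.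
by rewrite invfM mulrC -exprVn; apply: le_trans h; rewrite lerDr.
Qed.

(** The exponential beats every power at the origin: for [v < 1] the first factor is at most [v^-d]
    and the second is of order [v^(d+2)]. The square matches the order of vanishing of [ediff2]. *)
Lemma gker_le_sqr : exists2 C : R, 1 <= C &
  forall v, 0 < v -> gker v <= C * v ^+ 2.
Proof.
pose C : R := (d.+2)`!%:R * 4 ^+ d.+2; exists C.
  by rewrite /C -natrX -natrM ler1n muln_gt0 fact_gt0 expn_gt0.
have C1 : 1 <= C by rewrite /C -natrX -natrM ler1n muln_gt0 fact_gt0 expn_gt0.
move=> v v0; have [v1|v1] := leP 1 v.
  apply: le_trans (gker_le1 _ v1) _.
  by rewrite -[leLHS]mulr1 ler_pM// exprn_ege1.
have p1 := fourpi_ge1.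
have h1 : (4 * pi * v) `^ (- (d%:R / 2)) <= v ^- d.
  rewrite powRN lef_pV2 ?posrE ?exprn_gt0 ?powR_gt0 ?mulr_gt0 ?pi_gt0//.
  rewrite -powR_mulrn ?(ltW v0)//.
  apply: (@le_trans _ _ (v `^ (d%:R / 2))).
    have -> : v `^ d%:R = v `^ (d%:R / 2) * v `^ (d%:R / 2).
      by rewrite -powRD -?splitr// (gt_eqF v0) implybT.
    rewrite ler_piMr ?powR_ge0//.
    rewrite -[leRHS](_ : 1 `^ (d%:R / 2) = 1); last by rewrite powR1.
    by apply: ge0_ler_powR; rewrite ?divr_ge0 ?nnegrE// ltW.
  apply: ge0_ler_powR; rewrite ?divr_ge0 ?nnegrE// ?(ltW v0)//.
    by rewrite ltW// !mulr_gt0 ?pi_gt0.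
  by rewrite ler_peMl// ltW.
apply: (@le_trans _ _ (v ^- d * (d.+2`!%:R * (4 * v) ^+ d.+2))).
  by rewrite ler_pM ?powR_ge0 ?expR_ge0// expRN_inv_le.
rewrite exprMn /C (_ : v ^+ d.+2 = v ^+ d * v ^+ 2); last by rewrite -exprD addn2.
have : v ^+ d != 0 by rewrite expf_neq0// gt_eqF.
move: (d.+2`!%:R : R) (4 ^+ d.+2 : R) (v ^+ d) => F Z V V0.
by rewrite le_eqVlt; apply/orP; left; apply/eqP; field.
Qed.

Lemma gker_le_min : exists2 C : R, 1 <= C &
  forall v, 0 < v -> gker v <= C * Num.min 1 v.
Proof.
have [C C1 h] := gker_le_sqr; exists C => // v v0.
have [v1|v1] := leP 1 v.
  by rewrite mulr1 (le_trans (gker_le1 _ v1)).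
apply: le_trans (h _ v0) _; rewrite ler_wpM2l//; first lra.
by rewrite expr2 ler_piMl ?ltW.
Qed.

(** Passing to [v / 4] multiplies the power factor by [2^d >= 8] and, for [v >= 4], the exponential
    factor by at least 3/4; the product is 6. This is where the dimension enters. *)
Lemma gker_quarter v : (3 <= d)%N -> 4 <= v -> gker v <= 6^-1 * gker (v / 4).
Proof.
move=> d3 v4; have v0 : 0 < v by lra.
have p1 := fourpi_ge1.
have -> : gker (v / 4) =
    2 ^+ d * ((4 * pi * v) `^ (- (d%:R / 2)) * expR (- v^-1)).
  rewrite /gker (_ : 4 * (v / 4) = v); last by field.
  rewrite mulrA (powRM _ (_ : 0 <= 4 * pi * v)); last 2 first.
  - by rewrite !mulr_ge0 ?pi_ge0 ?ltW.
  - by rewrite invr_ge0.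
  rewrite [in RHS]mulrA (mulrC (2 ^+ d)); congr (_ * _ * _).
  have -> : 4^-1 = 2 `^ (- 2%:R) :> R by rewrite powR_invn//; field.
  rewrite -powRrM (_ : - 2%:R * - (d%:R / 2) = d%:R) ?powR_mulrn//.
  by field.
have h8 : 8 <= 2 ^+ d :> R.
  by rewrite (_ : 8 = 2 ^+ 3) ?ler_eXn2l ?ltr1n//; ring.
have he : 3 / 4 * expR (- (4 * v)^-1) <= expR (- v^-1).
  have -> : - v^-1 = - (3 / 4 * v^-1) + - (4 * v)^-1.
    by field; rewrite gt_eqF.
  rewrite expRD ler_wpM2r ?expR_ge0//.
  have := expR_ge1Dx (- (3 / 4 * v^-1)).
  have : v^-1 <= 4^-1 by rewrite lef_pV2 ?posrE.
  by lra.
rewrite /gker; set P := _ `^ _; set E := expR (- (4 * v)^-1) in he *.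
have P0 : 0 <= P by exact: powR_ge0.
have E0 : 0 <= E by exact: expR_ge0.
move: (2 ^+ d) (expR (- v^-1)) h8 he => Z F h8 he.
have -> : 6^-1 * (Z * (P * F)) = P * (6^-1 * (Z * F)) by ring.
rewrite ler_wpM2l//.
have : 8 * (3 / 4 * E) <= Z * F by rewrite ler_pM ?mulr_ge0.
by lra.
Qed.

(* Only [6^-1 < 4^-1] matters: rescaling by 4 against a non-increasing density
   loses a factor 4. *)
Lemma gker_le_ediff2 : (3 <= d)%N -> exists2 C : R, 0 < C &
  forall v, 0 < v -> gker v <= C * ediff2 v + 6^-1 * gker (v / 4).
Proof.
move=> d3; have [C C1 h] := gker_le_sqr.
have C0 : 0 < C by lra.
(* For [v < 4] the kernel is at most [C v^2], and [ediff2 v >= v^2 e^(-3v)] with [3v < 12]. *)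
exists (C * expR 12); first by rewrite mulr_gt0 ?expR_gt0.
move=> v v0; have [v4|v4] := leP 4 v.
  rewrite (le_trans (gker_quarter _ d3 v4))// lerDr mulr_ge0 ?ediff2_ge0//.
  by rewrite mulr_ge0 ?expR_ge0 ?ltW.
rewrite (le_trans (h _ v0))// -[leLHS]addr0 lerD//; last first.
  by rewrite pmulr_rge0 ?gker_ge0.
rewrite -mulrA ler_pM2l//.
apply: le_trans (ler_wpM2l (expR_ge0 12) (ediff2_ge _ (ltW v0))).
by rewrite mulrCA ler_peMr ?sqr_ge0// -expRD -[leLHS]expR0 ler_expR; lra.
Qed.

(** Each of the ranges [v <= eps], [v >= M] and the one between is handled by a single term. In the
    middle [ediff] is at most 1 and the Gaussian kernel is bounded below. *)
Lemma ediff_le_gker eps M : 0 < eps -> eps <= M -> exists2 c : R, 0 < c &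
  forall v, 0 < v -> ediff v <= c * gker v
    + expR 2 * eps * ediff (v / eps) + 2 * expR (- (M / 2)) * ediff (v / 2).
Proof.
move=> e0 eM; have M0 : 0 < M by exact: lt_le_trans eM.
pose c := (4 * pi * M) `^ (- (d%:R / 2)) * expR (- (4 * eps)^-1).
have c0 : 0 < c.
  rewrite /c pmulr_lgt0 ?expR_gt0//; apply: powR_gt0.
  by rewrite !mulr_gt0 ?pi_gt0.
exists c^-1; first by rewrite invr_gt0.
move=> v v0.
have A0 : 0 <= c^-1 * gker v by rewrite pmulr_rge0 ?gker_ge0 ?invr_gt0.
have B0 : 0 <= expR 2 * eps * ediff (v / eps).
  by rewrite !mulr_ge0 ?expR_ge0 ?ediff_ge0 ?divr_ge0 ?ltW.
have D0 : 0 <= 2 * expR (- (M / 2)) * ediff (v / 2).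
  by rewrite !mulr_ge0 ?expR_ge0 ?ediff_ge0 ?divr_ge0 ?ltW.
have [ve|ve] := leP v eps.
  by have := ediff_small _ _ e0 (ltW v0) ve; lra.
have [Mv|Mv] := leP M v.
  by have := ediff_large _ _ (ltW v0) Mv; lra.
have : 1 <= c^-1 * gker v.
  by rewrite ler_pdivlMl// mulr1 gker_lower ?ltW.
by have := ediff_le1 _ (ltW v0); lra.
Qed.

End gaussian_kernel.

(** * Functions dominated by a multiple of [min(1, s)] *)

Section tame_functions.
Context {R : realType}.
Implicit Types (f g : R -> R) (u c : R).

(* The functions controlled by the integrability condition on a Lévy measure. *)
Definition tame f := measurable_fun (`]0, +oo[ : set R) f /\
  exists C : R, forall s, 0 < s -> `|f s| <= C * Num.min 1 s.

Lemma tameB f g : tame f -> tame g -> tame (fun s => f s - g s).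
Proof.
move=> [mf [C hC]] [mg [E hE]]; split; first exact: measurable_funB.
exists (C + E) => s s0; rewrite mulrDl (le_trans (ler_normB _ _))//.
by rewrite lerD ?hC ?hE.
Qed.

Lemma tameZ c f : tame f -> tame (fun s => c * f s).
Proof.
move=> [mf [C hC]]; split; first exact: measurable_funM.
by exists (`|c| * C) => s s0; rewrite normrM -mulrA ler_wpM2l ?hC.
Qed.

Lemma tameD f g : tame f -> tame g -> tame (fun s => f s + g s).
Proof.
move=> [mf [C hC]] [mg [E hE]]; split; first exact: measurable_funD.
exists (C + E) => s s0; rewrite mulrDl (le_trans (ler_normD _ _))//.
by rewrite lerD ?hC ?hE.
Qed.

Lemma le_tame C A B f : measurable_fun (`]0, +oo[ : set R) f ->
  (forall s : R, 0 < s -> `|f s| <= A) ->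
  (forall s : R, 0 < s -> `|f s| <= B * s) ->
  A <= C -> B <= C -> tame f.
Proof.
move=> mf hA hB AC BC; split => //; exists C => s s0.
have [s1|s1] := leP 1 s.
  by rewrite mulr1 (le_trans (hA _ s0)).
by rewrite (le_trans (hB _ s0))// ler_wpM2r// ltW.
Qed.

Lemma measurable_expRN u (D : set R) :
  measurable_fun D (fun s : R => expR (- (u * s))).
Proof.
apply: measurable_funTS; apply: measurableT_comp => //.
by apply: measurable_funN; exact: mulrl_measurable.
Qed.

Lemma tame_onem_expRN u : 0 <= u -> tame (fun s => 1 - expR (- (u * s))).
Proof.
move=> u0; apply: (@le_tame (1 + u) 1 u).
- by apply: measurable_funB => //; exact: measurable_expRN.
- by move=> s s0; rewrite ger0_norm ?onem_expRN_ge0 ?mulr_ge0 ?(ltW s0).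
- move=> s s0; rewrite ger0_norm ?onem_expRN_ge0 ?mulr_ge0 ?(ltW s0)//.
  exact: onem_expRN_le.
- by rewrite lerDl.
- by rewrite lerDr.
Qed.

Lemma mul_expRN_le1 (v : R) : v * expR (- v) <= 1.
Proof. by apply: le_trans (onem_expRN_ge v) _; rewrite gerBl expR_ge0. Qed.

Lemma mul_expRN_le u s : 0 < u -> s * expR (- (u * s)) <= u^-1.
Proof.
by move=> u0; rewrite -[leRHS]mulr1 ler_pdivlMl// mulrA mul_expRN_le1.
Qed.

Lemma tame_mul_expRN u : 0 < u -> tame (fun s => s * expR (- (u * s))).
Proof.
move=> u0; apply: (@le_tame (1 + u^-1) u^-1 1).
- by apply: measurable_funM => //; exact: measurable_expRN.
- move=> s s0; rewrite ger0_norm ?mulr_ge0 ?expR_ge0 ?(ltW s0)//.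
  exact: mul_expRN_le.
- move=> s s0; rewrite ger0_norm ?mulr_ge0 ?expR_ge0 ?(ltW s0)//.
  by rewrite mulrC ler_wpM2r ?(ltW s0)// expR_le1 oppr_le0 mulr_ge0 ?ltW.
- by rewrite lerDr.
- by rewrite lerDl invr_ge0 ltW.
Qed.

Lemma tame_sqr_expRN u : 0 < u -> tame (fun s => s ^+ 2 * expR (- (u * s))).
Proof.
move=> u0; have u20 : 0 < u / 2 by rewrite divr_gt0.
have a0 : 0 <= (u / 2) ^- 2 by rewrite invr_ge0 exprn_ge0 ?ltW.
have b0 : 0 <= u^-1 by rewrite invr_ge0 ltW.
apply: (@le_tame (u^-1 + (u / 2) ^- 2) ((u / 2) ^- 2) u^-1).
- by apply: measurable_funM => //; exact: measurable_expRN.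
- move=> s s0; rewrite ger0_norm ?(mulr_ge0 (sqr_ge0 _)) ?expR_ge0//.
  (* Half of the exponential goes to each factor [s], so the bound is the square of the one for
     [s e^(-us/2)]. *)
  have -> : expR (- (u * s)) = expR (- (u / 2 * s)) ^+ 2.
    by rewrite -expRN2; congr (expR _); field.
  rewrite -exprMn -exprVn lerXn2r ?nnegrE ?mul_expRN_le//.
    by rewrite mulr_ge0 ?expR_ge0 ?ltW.
  by rewrite invr_ge0 ltW.
- move=> s s0; rewrite ger0_norm ?(mulr_ge0 (sqr_ge0 _)) ?expR_ge0//.
  by rewrite expr2 -mulrA mulrC ler_wpM2r ?(ltW s0)// mul_expRN_le.
- by rewrite lerDr.
- by rewrite lerDl.
Qed.

Lemma eq_tame f g : (forall s, f s = g s) -> tame f -> tame g.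
Proof. by move=> /funext ->. Qed.

Lemma tame_ediff u : 0 <= u -> tame (fun s => ediff (u * s)).
Proof.
move=> u0; have u2 : 0 <= 2 * u by rewrite mulr_ge0.
apply: eq_tame (tameB _ _ (tame_onem_expRN _ u2) (tame_onem_expRN _ u0)) => s.
by rewrite /ediff mulrA; lra.
Qed.

Lemma tame_ediff2 u : 0 <= u -> tame (fun s => ediff2 (u * s)).
Proof.
move=> u0; have u2 : 0 <= 2 * u by rewrite mulr_ge0.
have u3 : 0 <= 3 * u by rewrite mulr_ge0.
apply: eq_tame (tameB _ _ (tameZ 2 _ (tame_onem_expRN _ u2))
  (tameD _ _ (tame_onem_expRN _ u0) (tame_onem_expRN _ u3))) => s.
by rewrite /ediff2 !mulrA; lra.
Qed.

Lemma tame_gker d u : 0 < u -> tame (fun s => gker d (u * s)).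
Proof.
move=> u0; have [C C1 hC] := @gker_le_min R d.
have C0 : 0 <= C by lra.
apply: (@le_tame (C * (1 + u)) C (C * u)).
- apply: measurable_funM.
    apply: measurable_funTS.
    apply: (@measurableT_comp _ _ _ _ _ _ (@powR R ^~ (- (d%:R / 2)))).
      exact: measurable_powR.
    under eq_fun do rewrite mulrA.
    exact: mulrl_measurable.
  (* On [s > 0] the inverse is the power with exponent -1, so measurability of powers covers this
     factor too. *)
  apply: (@eq_measurable_fun _ _ _ _ _
    (fun s => expR (- ((4 * (u * s)) `^ (-1))))).
    move=> s; rewrite inE/= in_itv/= andbT => s0.
    by rewrite powR_inv1// !mulr_ge0// ltW.
  apply: measurable_funTS; apply: measurableT_comp => //.
  apply: measurable_funN.
  apply: (@measurableT_comp _ _ _ _ _ _ (@powR R ^~ (-1))).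
    exact: measurable_powR.
  by under eq_fun do rewrite mulrA; exact: mulrl_measurable.
- move=> s s0; rewrite ger0_norm ?gker_ge0// (le_trans (hC _ _)) ?mulr_gt0//.
  by rewrite ler_piMr// ge_min lexx.
- move=> s s0; rewrite ger0_norm ?gker_ge0// (le_trans (hC _ _)) ?mulr_gt0//.
  by rewrite -mulrA ler_wpM2l// ge_min lexx orbT.
- by rewrite ler_peMr// lerDl ltW.
- by rewrite ler_wpM2l// lerDr.
Qed.

End tame_functions.

(** * Integrating the kernel inequalities against an abstract functional *)

Section positive_functionals.
Context {R : realType}.
Implicit Types (J : (R -> R) -> R) (f g : R -> R).

(** Abstracts the integrals against [m(s) ds] and against the law of [T_t], so that the bounds on
    [nu] and on [p] share their proofs. *)
Record positive_functional J : Prop := PositiveFunctional {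
  pf_le : forall f g, tame f -> tame g ->
    (forall s, 0 < s -> f s <= g s) -> J f <= J g ;
  pf_add : forall f g, tame f -> tame g -> J (fun s => f s + g s) = J f + J g ;
  pf_scale : forall c f, tame f -> J (fun s => c * f s) = c * J f }.

(** The constant is fixed before [J] and [u], which makes the later bounds uniform in [t] and
    [x]. *)
Lemma functional_ediff_le d (eps M : R) : 0 < eps -> eps <= M ->
  exists2 c : R, 0 < c & forall J, positive_functional J -> forall u, 0 < u ->
    J (fun s => ediff (u * s)) <= c * J (fun s => gker d (u * s))
      + expR 2 * eps * J (fun s => ediff (u / eps * s))
      + 2 * expR (- (M / 2)) * J (fun s => ediff (u / 2 * s)).
Proof.
move=> e0 eM; have [c c0 h] := @ediff_le_gker R d eps M e0 eM.
exists c => // J [Jle JD JZ] u u0.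
have u00 := ltW u0; have ue0 : 0 <= u / eps by rewrite divr_ge0 ?ltW.
have u20 : 0 <= u / 2 by rewrite divr_ge0.
have t1 := tame_gker d _ u0; have t2 := tame_ediff _ ue0.
have t3 := tame_ediff _ u20.
rewrite -(JZ _ _ t1) -(JZ _ _ t2) -(JZ _ _ t3) -JD; [|exact: tameZ..].
rewrite -JD; [|by apply: tameD; exact: tameZ|exact: tameZ].
apply: Jle => [||s s0]; first exact: tame_ediff.
  by apply: tameD; [apply: tameD; exact: tameZ|exact: tameZ].
apply: le_trans (h _ (mulr_gt0 u0 s0)) _.
by rewrite (mulrAC u s) (mulrAC u s).
Qed.

Lemma functional_gker_le d : (3 <= d)%N ->
  exists2 C : R, 0 < C & forall J, positive_functional J -> forall u, 0 < u ->
    J (fun s => gker d (u * s)) <= C * J (fun s => ediff2 (u * s))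
      + 6^-1 * J (fun s => gker d (u / 4 * s)).
Proof.
move=> d3; have [C C0 h] := @gker_le_ediff2 R d d3.
exists C => // J [Jle JD JZ] u u0.
have u40 : 0 < u / 4 by rewrite divr_gt0.
have t1 := tame_ediff2 _ (ltW u0); have t2 := tame_gker d _ u40.
rewrite -(JZ _ _ t1) -(JZ _ _ t2) -JD; [|exact: tameZ..].
apply: Jle => [||s s0]; first exact: tame_gker.
  by apply: tameD; exact: tameZ.
apply: le_trans (h _ (mulr_gt0 u0 s0)) _.
by rewrite (mulrAC u s).
Qed.

End positive_functionals.

(** Here [E] is [e^2], [y] is [e^(-M/2)], and [k1], [k2], [k3] stand for [phi'] at [u/2], [lam u],
    [u]; [j2], [j3], [j4] are the integrals of [ediff] at these scales and [j1] that of the Gaussian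
    kernel. Each error term, multiplied by [4 E], is at most a quarter of [t u k3], so half of the
    left side survives. *)
Lemma absorb_error_terms {R : realType}
    {E y c lam t u k1 k2 k3 j1 j2 j3 j4 : R} :
  0 < lam -> 0 < E -> 0 <= y -> 64 * E * y <= 1 -> 0 < t -> 0 < u ->
  t * (u * k3) <= 4 * E * j4 ->
  j3 <= t * (lam * u * k2) -> j2 <= t * (u / 2 * k1) ->
  k2 <= (16 * E ^+ 2)^-1 * k3 -> k1 <= 4 * k3 -> 0 <= k3 ->
  j4 <= c * j1 + E / lam * j3 + 2 * y * j2 ->
  t * (u * k3) <= 8 * E * c * j1.
Proof.
move=> l0 E0 y0 Ey t0 u0 h4 h3 h2 hk2 hk1 k0 hj.
have tu0 : 0 < t * u by rewrite mulr_gt0.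
have T0 : 0 <= t * u * k3 by rewrite mulr_ge0// ltW.
have b3 : 16 * E * (E / lam * j3) <= t * u * k3.
  apply: (@le_trans _ _ (16 * E * (E / lam * (t * (lam * u * k2))))).
    by rewrite ler_pM2l ?mulr_gt0// ler_pM2l// divr_gt0.
  have -> : 16 * E * (E / lam * (t * (lam * u * k2))) =
      t * u * (16 * E ^+ 2 * k2) by field; rewrite gt_eqF.
  by rewrite ler_pM2l// -ler_pdivlMl ?mulr_gt0 ?exprn_gt0.
have b2 : 16 * E * (2 * y * j2) <= t * u * k3.
  have j2b : j2 <= 2 * (t * u * k3).
    apply: le_trans h2 _; have -> : t * (u / 2 * k1) = t * u * (2^-1 * k1) by ring.
    have -> : 2 * (t * u * k3) = t * u * (2 * k3) by ring.
    by rewrite ler_pM2l//; lra.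
  apply: (@le_trans _ _ (16 * E * (2 * y * (2 * (t * u * k3))))).
    by rewrite ler_pM2l ?mulr_gt0// ler_wpM2l// mulr_ge0.
  have -> : 16 * E * (2 * y * (2 * (t * u * k3))) = 64 * E * y * (t * u * k3).
    by ring.
  by rewrite ler_piMl.
have := ler_wpM2l (ltW E0) hj.
by lra.
Qed.

(** The exponent solves [2^alpha = rho^-1], so a full doubling reproduces the scaling factor
    exactly. *)
Lemma doubling_WUSC {R : realType} (f : R -> R) (theta rho : R) :
  0 <= theta -> 0 < rho -> rho < 1 ->
  (forall x, theta < x -> 0 <= f x) ->
  (forall x y, theta < x -> x <= y -> f y <= f x) ->
  (forall x, theta < x -> f (2 * x) <= rho * f x) ->
  exists2 alpha, 0 < alpha & WUSC f (- alpha) theta rho^-1.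
Proof.
move=> th0 r0 r1 f0 fni fd.
have ln2 : 0 < ln 2 :> R by rewrite ln_gt0 ?ltr1n.
have [alpha a0 two_alpha] : exists2 alpha, 0 < alpha & 2 `^ alpha = rho^-1.
  exists (- ln rho / ln 2).
    by rewrite divr_gt0// oppr_gt0 ln_lt0// r0.
  by rewrite /powR pnatr_eq0/= divfK ?gt_eqF// expRN lnK.
exists alpha => //.
suff H (n : nat) : forall lam x, 1 <= lam -> lam <= 2 ^+ n -> theta < x ->
    f (lam * x) <= rho^-1 * lam `^ (- alpha) * f x.
  move=> lam x l1 x0.
  have [n hn] : exists n : nat, lam <= 2 ^+ n.
    exists (Num.trunc lam).+1.
    have l0 : 0 <= lam by lra.
    apply: ltW; apply: lt_le_trans (truncnS_gt lam) _.
    by rewrite -natrX ler_nat ltnW// ltn_expl.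
  exact: (H n).
elim: n => [|n IH] lam x l1 ln x0; have x00 : 0 < x by exact: le_lt_trans x0.
  have -> : lam = 1 by apply/eqP; rewrite eq_le l1 andbT.
  by rewrite powR1 mul1r mulr1 ler_peMl ?f0// invf_ge1// ltW.
(* Below one full doubling only monotonicity is available; [lam^alpha <= 2^alpha = rho^-1] is paid
   for by the constant [rho^-1]. *)
have [l2|l2] := leP lam 2.
  apply: (@le_trans _ _ (f x)).
    by rewrite fni// ler_peMl// ltW.
  rewrite ler_peMl ?f0// powRN -two_alpha.
  rewrite ler_pdivlMr ?(powR_gt0 _ (lt_le_trans ltr01 l1))//.
  by rewrite mul1r; apply: ge0_ler_powR; rewrite ?nnegrE//; lra.
have x2 : theta < 2 * x by lra.
have hl1 : 1 <= lam / 2 by lra.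
have hln : lam / 2 <= 2 ^+ n by rewrite ler_pdivrMr// -exprSr.
have := IH _ _ hl1 hln x2.
have -> : lam / 2 * (2 * x) = lam * x by field.
move=> /le_trans; apply.
have -> : (lam / 2) `^ (- alpha) = lam `^ (- alpha) * rho^-1.
  rewrite powRM ?invr_ge0//; last by lra.
  congr (_ * _); rewrite -two_alpha -powR_inv1// -powRrM.
  by congr (_ `^ _); ring.
rewrite -!mulrA ler_pM2l ?invr_gt0// ler_pM2l ?(powR_gt0 _ (lt_le_trans ltr01 l1))//.
by rewrite ler_pdivrMl// fd.
Qed.

(** * The Bernstein function, its derivative and the Lévy integrals *)

Section levy_density.
Context {R : realType} (m : R -> R).
Hypothesis m_ge0 : forall s, 0 < s -> 0 <= m s.
Hypothesis m_noninc : forall s s', 0 < s -> s <= s' -> m s' <= m s.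
Hypothesis m_levy :
  (\int[@lebesgue_measure R]_(s in `]0%R, +oo[) (Num.min 1 s * m s)%:E < +oo)%E.
Implicit Types (f : R -> R) (u a b : R).

Local Notation I := (wint (@lebesgue_measure R) `]0, +oo[ m).
Local Notation integrable := (wintegrable (@lebesgue_measure R) `]0, +oo[ m).

(** Superlevel sets of a monotone function are intervals. *)
Lemma measurable_levy_density : measurable_fun (`]0, +oo[ : set R) m.
Proof.
move=> mD; apply: (measurability (@RGenCInfty.G R)) => //.
  exact: RGenCInfty.measurableE.
move=> /= _ [_] [r] -> <-; apply: is_interval_measurable => s t/=.
rewrite !in_itv/= !andbT => -[s0 rs] [t0 rt] x /andP[sx xt].
have x0 : 0 < x by exact: lt_le_trans sx.
by rewrite in_itv/= andbT in_itv/= andbT; split => //; rewrite (le_trans rt) ?m_noninc.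
Qed.

Let m0D s : (`]0, +oo[%classic : set R) s -> 0 <= m s.
Proof. by rewrite /= in_itv/= andbT => /m_ge0. Qed.

Lemma tame_integrable f : tame f -> integrable f.
Proof.
move=> [mf [C hC]].
refine (@le_wintegrable _ _ _ (@lebesgue_measure R) _ _ _
  measurable_levy_density C f (fun s => Num.min 1 s) mf _ _).
- exact: measurable_itv.
- apply/integrableP; split.
    apply/measurable_EFinP; apply: measurable_funM.
      exact: measurable_minr.
    exact: measurable_levy_density.
  rewrite (le_lt_trans _ m_levy)// le_eqVlt; apply/orP; left; apply/eqP.
  apply: eq_integral => s; rewrite inE/= in_itv/= andbT => s0.
  by rewrite ger0_norm// mulr_ge0 ?m_ge0// le_min ler01 ltW.
- by move=> s /=; rewrite in_itv/= andbT => /hC.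
Qed.

Lemma levy_le f g : tame f -> tame g -> (forall s, 0 < s -> f s <= g s) ->
  I f <= I g.
Proof.
move=> tf tg fg; apply: wint_le => //; try exact: tame_integrable.
by move=> s /=; rewrite in_itv/= andbT => /fg.
Qed.

Lemma levy_ge0 f : (forall s, 0 < s -> 0 <= f s) -> 0 <= I f.
Proof.
by move=> f0; apply: wint_ge0 => // s /=; rewrite in_itv/= andbT => /f0.
Qed.

Lemma levyD f g : tame f -> tame g -> I (fun s => f s + g s) = I f + I g.
Proof. by move=> tf tg; apply: wintD => //; exact: tame_integrable. Qed.

Lemma levyB f g : tame f -> tame g -> I (fun s => f s - g s) = I f - I g.
Proof. by move=> tf tg; apply: wintB => //; exact: tame_integrable. Qed.

Lemma levyZ c f : tame f -> I (fun s => c * f s) = c * I f.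
Proof. by move=> tf; apply: wintZ => //; exact: tame_integrable. Qed.

(** Substituting [c s] for [s] produces the factor [c] and the density [m(c s)], which is at most
    [m(s)]. *)
Lemma levy_rescale (c : R) f : 1 <= c -> tame f -> tame (fun s => f (s / c)) ->
  (forall s, 0 < s -> 0 <= f s) -> I (fun s => f (s / c)) <= c * I f.
Proof.
move=> c1 tf tfc f0; have c0 : 0 < c by lra.
have mm := measurable_levy_density.
have mcm : measurable_fun (`]0, +oo[ : set R) (m \o *%R c).
  apply: (measurable_comp (F := (`]0, +oo[ : set R))) => //.
  by move=> t [s] /=; rewrite !in_itv/= !andbT => s0 <-; rewrite mulr_gt0.
have mfm g : tame g -> measurable_fun (`]0, +oo[ : set R) (fun s => (g s * m s)%:E).
  by move=> [mg _]; apply/measurable_EFinP; exact: measurable_funM.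
rewrite /wint /Rintegral.
have fi g : tame g -> (\int[@lebesgue_measure R]_(s in `]0%R, +oo[) (g s * m s)%:E)%E
    \is a fin_num.
  by move=> tg; apply: integrable_fin_num => //; exact: tame_integrable.
rewrite -[c in leRHS]/(fine c%:E) -fineM//; last exact: fi.
apply: fine_le; [exact: fi| by rewrite fin_numM// fi|].
rewrite (ge0_integral_scale _ _ c0); last 2 first.
- exact: (mfm _ tfc).
- by move=> s s0; rewrite lee_fin mulr_ge0 ?m_ge0 ?f0 ?divr_gt0.
apply: lee_wpmul2l; first by rewrite lee_fin ltW.
have cs (s : R) : c * s / c = s by rewrite mulrC mulKf// gt_eqF.
apply: ge0_le_integral => //.
- move=> s /=; rewrite in_itv/= andbT => s0.
  by rewrite cs lee_fin mulr_ge0 ?m_ge0 ?f0 ?mulr_gt0.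
- have -> : (fun s => (f (c * s / c) * m (c * s))%:E) =
           (fun s => (f s * m (c * s))%:E) by apply/funext => s; rewrite cs.
  apply/measurable_EFinP; apply: measurable_funM; first by case: tf.
  exact: mcm.
- exact: mfm.
- move=> s /=; rewrite in_itv/= andbT => s0.
  by rewrite cs lee_fin ler_wpM2l ?f0// m_noninc// ler_peMl// ltW.
Qed.

Lemma expRN_diffE a b s :
  expR (- (b * s)) = expR (- (a * s)) * expR (- ((b - a) * s)).
Proof. by rewrite -expRD; congr expR; ring. Qed.

(** Factor out [e^(-as)] and use [x e^-x <= 1 - e^-x]. The order of [a] and [b] is left free, so
    that increments of either sign are covered. *)
Lemma expRN_diff_ge a b s :
  (b - a) * (s * expR (- (b * s))) <= expR (- (a * s)) - expR (- (b * s)).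
Proof.
have := onem_expRN_ge ((b - a) * s).
rewrite -(ler_pM2l (expR_gt0 (- (a * s)))) mulrBr mulr1 mulrCA -expRN_diffE.
by rewrite -mulrA.
Qed.

Lemma expRN_diff_le a b s :
  expR (- (a * s)) - expR (- (b * s)) <= (b - a) * (s * expR (- (a * s))).
Proof.
have := onem_expRN_le ((b - a) * s).
rewrite -(ler_pM2l (expR_gt0 (- (a * s)))) mulrBr mulr1 -expRN_diffE.
by rewrite [X in _ -> _ <= X]mulrA [X in _ -> _ <= X]mulrC.
Qed.

Lemma tame_expRN_diff a b : 0 <= a -> 0 <= b ->
  tame (fun s => expR (- (a * s)) - expR (- (b * s))).
Proof.
move=> a0 b0.
apply: eq_tame (tameB _ _ (tame_onem_expRN _ b0) (tame_onem_expRN _ a0)) => s.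
by lra.
Qed.

Lemma bern_phiE u : bern_phi m u = I (fun s => 1 - expR (- (u * s))).
Proof. by []. Qed.

Lemma bern_phiB a b : 0 <= a -> 0 <= b -> bern_phi m b - bern_phi m a =
  I (fun s => expR (- (a * s)) - expR (- (b * s))).
Proof.
move=> a0 b0; rewrite !bern_phiE -levyB; [|exact: tame_onem_expRN..].
by apply: eq_wint => s _; lra.
Qed.

Lemma levy_ediff u : 0 <= u ->
  I (fun s => ediff (u * s)) = bern_phi m (2 * u) - bern_phi m u.
Proof.
move=> u0; have u2 : 0 <= 2 * u by rewrite mulr_ge0.
rewrite (bern_phiB _ _ u0 u2).
by apply: eq_wint => s _; rewrite /ediff mulrA.
Qed.

Lemma levy_ediff2 u : 0 <= u -> I (fun s => ediff2 (u * s)) =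
  2 * bern_phi m (2 * u) - (bern_phi m u + bern_phi m (3 * u)).
Proof.
move=> u0; have u2 : 0 <= 2 * u by rewrite mulr_ge0.
have u3 : 0 <= 3 * u by rewrite mulr_ge0.
rewrite !bern_phiE -levyZ; last exact: tame_onem_expRN.
rewrite -levyD; [|exact: tame_onem_expRN..].
rewrite -levyB; last first.
- by apply: tameD; exact: tame_onem_expRN.
- by apply: tameZ; exact: tame_onem_expRN.
by apply: eq_wint => s _; rewrite /ediff2 !mulrA; lra.
Qed.

Lemma bern_phi_ge0 u : 0 <= u -> 0 <= bern_phi m u.
Proof.
move=> u0; rewrite bern_phiE; apply: levy_ge0 => s s0.
by rewrite onem_expRN_ge0// mulr_ge0// ltW.
Qed.

Lemma bern_phi_nondecreasing a b : 0 <= a -> a <= b ->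
  bern_phi m a <= bern_phi m b.
Proof.
move=> a0 ab; have b0 : 0 <= b by exact: le_trans ab.
rewrite -subr_ge0 (bern_phiB _ _ a0 b0); apply: levy_ge0 => s s0.
by rewrite subr_ge0 ler_expR lerN2 ler_wpM2r// ltW.
Qed.

Lemma bern_phi_double u : 0 <= u -> bern_phi m (2 * u) <= 2 * bern_phi m u.
Proof.
move=> u0; rewrite !bern_phiE -levyZ; last exact: tame_onem_expRN.
apply: levy_le => [||s s0]; first by apply: tame_onem_expRN; rewrite mulr_ge0.
  by apply: tameZ; exact: tame_onem_expRN.
rewrite -mulrA expRN2; have := sqr_ge0 (1 - expR (- (u * s))); lra.
Qed.

(** The integral form of [phi'], identified with the derivative in [bern_dphiE]. *)
Definition laplace_sm u : R := I (fun s => s * expR (- (u * s))).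

Lemma laplace_smE u : laplace_sm u = I (fun s => s * expR (- (u * s))).
Proof. by []. Qed.

Lemma laplace_sm_ge0 u : 0 <= laplace_sm u.
Proof.
by rewrite laplace_smE; apply: levy_ge0 => s s0; rewrite mulr_ge0 ?expR_ge0 ?ltW.
Qed.

Lemma laplace_sm_nonincreasing a b : 0 < a -> a <= b ->
  laplace_sm b <= laplace_sm a.
Proof.
move=> a0 ab; have b0 : 0 < b by exact: lt_le_trans ab.
rewrite !laplace_smE; apply: levy_le => [||s s0]; [exact: tame_mul_expRN..|].
by rewrite ler_pM2l// ler_expR lerN2 ler_pM2r.
Qed.

Lemma bern_phiB_ge a b : 0 < a -> 0 < b ->
  (b - a) * laplace_sm b <= bern_phi m b - bern_phi m a.
Proof.
move=> a0 b0; rewrite (bern_phiB _ _ (ltW a0) (ltW b0)) laplace_smE.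
rewrite -levyZ; last exact: tame_mul_expRN.
apply: levy_le => [||s s0]; last exact: expRN_diff_ge.
  by apply: tameZ; exact: tame_mul_expRN.
by apply: tame_expRN_diff; exact: ltW.
Qed.

Lemma bern_phiB_le a b : 0 < a -> 0 < b ->
  bern_phi m b - bern_phi m a <= (b - a) * laplace_sm a.
Proof.
by move=> a0 b0; rewrite -lerN2 -mulNr !opprB; exact: bern_phiB_ge.
Qed.

Lemma laplace_smB_le a b : 0 < a -> 0 < b ->
  laplace_sm a - laplace_sm b <=
  (b - a) * I (fun s => s ^+ 2 * expR (- (a * s))).
Proof.
move=> a0 b0; rewrite !laplace_smE -levyB; [|exact: tame_mul_expRN..].
rewrite -levyZ; last exact: tame_sqr_expRN.
apply: levy_le => [||s s0].
- by apply: tameB; exact: tame_mul_expRN.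
- by apply: tameZ; exact: tame_sqr_expRN.
rewrite -mulrBr expr2 -mulrA [leRHS]mulrCA ler_pM2l//.
exact: expRN_diff_le.
Qed.

(* [derive1] is an honest limit here: the difference quotients lie between
   [laplace_sm u] and [laplace_sm (u + h)], and [laplace_sm] is locally
   Lipschitz. *)
Lemma bern_dphiE u : 0 < u -> bern_dphi m u = laplace_sm u.
Proof.
move=> u0; have u20 : 0 < u / 2 by rewrite divr_gt0.
(* A Lipschitz constant for [laplace_sm] on [[u/2, oo)]; increments [h] with [|h| < u/2] stay in
   that range. *)
pose L := I (fun s => s ^+ 2 * expR (- (u / 2 * s))).
have L0 : 0 <= L by apply: levy_ge0 => s s0; rewrite mulr_ge0 ?expR_ge0 ?sqr_ge0.
have lip a b : u / 2 <= a -> a <= b -> laplace_sm a - laplace_sm b <= (b - a) * L.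
  move=> ua ab; have a0 : 0 < a by exact: lt_le_trans ua.
  have b0 : 0 < b by exact: lt_le_trans ab.
  apply: le_trans (laplace_smB_le _ _ a0 b0) _; rewrite ler_wpM2l ?subr_ge0//.
  apply: levy_le => [||s s0]; [exact: tame_sqr_expRN..|].
  by rewrite ler_wpM2l ?sqr_ge0// ler_expR lerN2 ler_pM2r.
have quot h : h != 0 -> `|h| < u / 2 ->
    `|laplace_sm u - h^-1 * (bern_phi m (h + u) - bern_phi m u)| <= `|h| * L.
  move=> hn0 hu; have hu0 : 0 < h + u by move: hu; rewrite ltr_norml => /andP[]; lra.
  have hneg : h < 0 -> u / 2 <= h + u /\ h + u <= u.
    by move=> h0; rewrite (ltr0_norm h0) in hu; split; lra.
  have hpos : 0 < h -> u / 2 <= u /\ u <= h + u by move=> h0; split; lra.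
  have lo := bern_phiB_ge _ _ u0 hu0; have up := bern_phiB_le _ _ u0 hu0.
  rewrite addrK in lo up.
  set q := h^-1 * _.
  have /orP[h0|h0] : (h < 0) || (0 < h) by rewrite -neq_lt.
  - have q1 : laplace_sm u <= q by rewrite ler_ndivlMl.
    have q2 : q <= laplace_sm (h + u) by rewrite ler_ndivrMl.
    have [hu1 hu2] := hneg h0.
    have := lip _ _ hu1 hu2; rewrite opprD addrCA subrr addr0 (ltr0_norm h0).
    rewrite distrC ger0_norm; last by rewrite subr_ge0.
    by apply: le_trans; rewrite lerD2r.
  - have q1 : q <= laplace_sm u by rewrite ler_pdivrMl.
    have q2 : laplace_sm (h + u) <= q by rewrite ler_pdivlMl.
    have [hu1 hu2] := hpos h0.
    have := lip _ _ hu1 hu2; rewrite addrK (gtr0_norm h0).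
    rewrite ger0_norm; last by rewrite subr_ge0.
    by apply: le_trans; rewrite lerD2l lerN2.
rewrite /bern_dphi /derive1; apply: cvg_lim => //.
apply/cvgrPdist_le => e e0; near=> h.
have hn0 : h != 0 by near: h; exact: nbhs_dnbhs_neq.
have hu : `|h| < u / 2.
  by near: h; apply: dnbhs0_lt.
have he : `|h| < e / (L + 1).
  by near: h; apply: dnbhs0_lt; rewrite divr_gt0// ltr_wpDl.
apply: le_trans (quot _ hn0 hu) _.
rewrite ltr_pdivlMr ?ltr_wpDl// in he.
by have := normr_ge0 h; lra.
Unshelve. all: by end_near. Qed.

(** One factor 2 comes from writing [s] as [2 (s/2)], the other from rescaling the non-increasing
    density. *)
Lemma laplace_sm_half u : 0 < u -> laplace_sm (u / 2) <= 4 * laplace_sm u.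
Proof.
move=> u0; have u20 : 0 < u / 2 by rewrite divr_gt0.
have E : forall s : R, 2 * ((s / 2) * expR (- (u * (s / 2)))) =
    s * expR (- (u / 2 * s)).
  move=> s; have -> : u * (s / 2) = u / 2 * s by field.
  by field.
have tE : tame (fun s => (s / 2) * expR (- (u * (s / 2)))).
  apply: eq_tame (tameZ 2^-1 _ (tame_mul_expRN _ u20)) => s.
  by rewrite -E; field.
have -> : laplace_sm (u / 2) =
    2 * I (fun s => (s / 2) * expR (- (u * (s / 2)))).
  by rewrite laplace_smE -levyZ//; apply: eq_wint => s _; rewrite E.
have := levy_rescale 2 (fun s => s * expR (- (u * s))) (ler1n _ 2) 
  (tame_mul_expRN _ u0) tE.
move=> /(_ _)/wrap[|h]; first by move=> s s0; rewrite mulr_ge0 ?expR_ge0 ?ltW.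
by rewrite (_ : 4 = 2 * 2) -?mulrA ?ler_pM2l//; ring.
Qed.

Lemma levy_positive_functional : positive_functional I.
Proof. by split; [exact: levy_le|exact: levyD|exact: levyZ]. Qed.

Lemma laplace_sm_double u : 0 < u -> laplace_sm u <= 4 * laplace_sm (2 * u).
Proof.
move=> u0; have := @laplace_sm_half (2 * u).
by rewrite [2 * u]mulrC mulfK// => -> //; rewrite mulr_gt0.
Qed.

(** The common core of the lower bounds on [nu] and [p]: the functional only has to give [ediff] the
    size [t w phi'(w)], from above at every scale and from below at [u]. *)
Lemma WUSC_functional_gker_ge d theta alpha cbar :
  0 <= theta -> 0 < alpha -> 1 <= cbar ->
  WUSC (bern_dphi m) (- alpha) theta cbar ->
  exists2 c : R, 0 < c & forall J, positive_functional J ->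
    forall t u, 0 < t -> theta < u ->
    t * (u * laplace_sm u) <= 4 * expR 2 * J (fun s => ediff (u * s)) ->
    (forall w, 0 < w -> J (fun s => ediff (w * s)) <= t * (w * laplace_sm w)) ->
    c * (t * (u * laplace_sm u)) <= J (fun s => gker d (u * s)).
Proof.
move=> th0 a0 c1 wusc.
have E1 : 1 <= expR 2 :> R by rewrite -[leLHS]expR0 ler_expR.
have E0 : 0 < expR 2 :> R by exact: expR_gt0.
(* With [lam = A^(1/alpha)] one gets [cbar lam^-alpha = 1 / (16 e^4)], the smallness of
   [phi'(lam u)] that absorbs the error at [eps = 1 / lam]. *)
pose A : R := 16 * expR 2 ^+ 2 * cbar.
have cb0 : 0 < cbar by exact: lt_le_trans c1.
have A1 : 1 <= A.
  rewrite -[leLHS]mulr1 ler_pM// -[leLHS]mulr1 ler_pM ?exprn_ege1//.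
  by rewrite ler1n.
have A0 : 0 < A by exact: lt_le_trans A1.
pose lam := A `^ alpha^-1.
have lam0 : 0 < lam by exact: powR_gt0.
have lam1 : 1 <= lam.
  by rewrite -[leLHS](powRr0 A) ler_powR// invr_ge0 ltW.
have lamA : cbar * lam `^ (- alpha) = (16 * expR 2 ^+ 2)^-1.
  rewrite -powRrM mulrN mulVf ?gt_eqF// powR_inv1 ?ltW// /A.
  by field; rewrite !gt_eqF.
(* Then [X = M / 2 = 64 e^2], and the smallness required of [e^(-M/2)] is just [X e^-X <= 1]. *)
pose M : R := 128 * expR 2.
have eM : lam^-1 <= M.
  rewrite (@le_trans _ _ 1) ?invf_le1// /M.
  by rewrite -[leLHS]mulr1 ler_pM// ler1n.
have MM : 64 * expR 2 * expR (- (M / 2)) <= 1.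
  have -> : M / 2 = 64 * expR 2 by rewrite /M; field.
  exact: mul_expRN_le1.
have [|c c0 h] := @functional_ediff_le R d lam^-1 M _ eM.
  by rewrite invr_gt0.
exists (8 * expR 2 * c)^-1; first by rewrite invr_gt0 !mulr_gt0.
move=> J pJ t u t0 thu low up.
have u0 : 0 < u by exact: le_lt_trans thu.
have lu0 : 0 < lam * u by rewrite mulr_gt0.
have u20 : 0 < u / 2 by rewrite divr_gt0.
have := h J pJ u u0; rewrite !invrK [u * lam]mulrC.
have Ju1 := up _ lu0; have Ju2 := up _ u20.
have K1 : laplace_sm (lam * u) <= (16 * expR 2 ^+ 2)^-1 * laplace_sm u.
  have := wusc _ _ lam1 thu.
  by rewrite lamA !bern_dphiE.
have K2 := laplace_sm_half _ u0.
have K0 := laplace_sm_ge0 u.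
rewrite ler_pdivrMl ?mulr_gt0//.
move: low Ju1 Ju2 K1 K2 K0.
exact: (absorb_error_terms lam0 E0 (expR_ge0 _) MM t0 u0).
Qed.

Lemma levy_nu_gker_ge d theta alpha cbar :
  0 <= theta -> 0 < alpha -> 1 <= cbar ->
  WUSC (bern_dphi m) (- alpha) theta cbar ->
  exists2 c : R, 0 < c & forall u, theta < u ->
    c * (u * laplace_sm u) <= I (fun s => gker d (u * s)).
Proof.
move=> th0 a0 c1 wusc.
have [c c0 h] := WUSC_functional_gker_ge d _ _ _ th0 a0 c1 wusc.
exists c => // u thu; have u0 : 0 < u by exact: le_lt_trans thu.
have := h _ levy_positive_functional 1 u ltr01 thu.
rewrite mul1r; apply.
(* The increment [phi(2u) - phi(u)] is at least [u phi'(2u)], hence at least a quarter of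
   [u phi'(u)]. *)
- rewrite (levy_ediff _ (ltW u0)).
  have u20 : 0 < 2 * u by rewrite mulr_gt0.
  have := bern_phiB_ge _ _ u0 u20; have := laplace_sm_double _ u0.
  have := laplace_sm_ge0 (2 * u).
  have : 1 <= expR 2 :> R by rewrite -[leLHS]expR0 ler_expR.
  move: (_ - bern_phi m _) (laplace_sm (2 * u)) (laplace_sm u) (expR 2).
  move=> D k2 k1 E E1 k20 k12.
  have -> : 2 * u - u = u by ring.
  move=> hD; apply: (@le_trans _ _ (4 * (u * k2))).
    by rewrite mulrCA ler_pM2l.
  rewrite -mulrA ler_pM2l// (le_trans hD)// ler_peMl//.
  by rewrite (le_trans _ hD)// mulr_ge0// ltW.
- move=> w w0; rewrite mul1r (levy_ediff _ (ltW w0)).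
  have w20 : 0 < 2 * w by rewrite mulr_gt0.
  have := bern_phiB_le _ _ w0 w20.
  by have -> : 2 * w - w = w by ring.
Qed.

(** Rescaling bounds the remainder by 4/6 of the left side, so a third is left and the constant
    triples. *)
Lemma levy_gker_le_ediff2 d : (3 <= d)%N -> exists2 C : R, 0 < C &
  forall u, 0 < u ->
    I (fun s => gker d (u * s)) <= C * I (fun s => ediff2 (u * s)).
Proof.
move=> d3; have [C C0 h] := @functional_gker_le R d d3.
exists (3 * C) => [|u u0]; first by rewrite mulr_gt0.
have := h _ levy_positive_functional u u0.
have u40 : 0 < u / 4 by rewrite divr_gt0.
have E : (fun s => gker d (u / 4 * s)) = (fun s => gker d (u * (s / 4))).
  by apply/funext => s; rewrite mulrA mulrAC.
have t4 : tame (fun s => gker d (u * (s / 4))) by rewrite -E; exact: tame_gker.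
have := levy_rescale 4 (fun s => gker d (u * s)) (ler1n _ 4)
  (tame_gker d _ u0) t4 (fun s _ => gker_ge0 _ _).
rewrite E.
by move: (I _) (I _) (I _) => i1 i2 i3; lra.
Qed.

Lemma levy_ediff2_le u : 0 < u ->
  I (fun s => ediff2 (u * s)) <= 2 * u * (laplace_sm (u / 2) - laplace_sm u).
Proof.
move=> u0; have u20 : 0 < u / 2 by rewrite divr_gt0.
rewrite !laplace_smE -levyB; [|exact: tame_mul_expRN..].
rewrite -levyZ; last by apply: tameB; exact: tame_mul_expRN.
apply: levy_le => [||s s0]; first by apply: tame_ediff2; exact: ltW.
  by apply: tameZ; apply: tameB; exact: tame_mul_expRN.
have us0 : 0 <= u * s by rewrite mulr_ge0 ?ltW.
apply: le_trans (ediff2_le _ us0) _.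
by rewrite -mulrBr (mulrAC u s) [leRHS]mulrA (mulrA 2).
Qed.

Lemma ediff2_WUSC theta C : 0 <= theta -> 0 < C ->
  (forall u, theta < u -> u * laplace_sm u <= C * I (fun s => ediff2 (u * s))) ->
  exists alpha cbar, 0 < alpha /\ 1 <= cbar /\
    WUSC (bern_dphi m) (- alpha) theta cbar.
Proof.
move=> th0 C0 h.
have pos x : theta < x -> 0 < x by exact: le_lt_trans.
(* The hypothesis at [2x] and [levy_ediff2_le] give [phi'(2x) <= 2C (phi'(x) - phi'(2x))]; solving
   for [phi'(2x)] yields [rho]. *)
pose rho := 2 * C / (1 + 2 * C).
have r0 : 0 < rho by rewrite divr_gt0 ?addr_gt0 ?mulr_gt0.
have r1 : rho < 1 by rewrite ltr_pdivrMr ?addr_gt0 ?mulr_gt0// mul1r ltrDr.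
have [|||alpha a0 wusc] := @doubling_WUSC R (bern_dphi m) theta rho th0 r0 r1.
- by move=> x /pos x0; rewrite bern_dphiE ?laplace_sm_ge0.
- move=> x y /pos x0 xy; have y0 : 0 < y by exact: lt_le_trans xy.
  by rewrite !bern_dphiE ?laplace_sm_nonincreasing.
- move=> x tx; have x0 := pos _ tx; have x20 : 0 < 2 * x by rewrite mulr_gt0.
  rewrite !bern_dphiE//.
  have t2x : theta < 2 * x by rewrite (lt_le_trans tx)// ler_peMl ?ltW ?ltr1n.
  have := levy_ediff2_le _ x20; have := h _ t2x.
  have -> : 2 * x / 2 = x by field.
  move: (I _) (laplace_sm _) (laplace_sm _) => i k2 k1 h1 h2.
  rewrite /rho mulrAC ler_pdivlMr ?addr_gt0 ?mulr_gt0//.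
  rewrite -(ler_pM2l x20).
  have := ler_wpM2l (ltW C0) h2; lra.
- exists alpha, rho^-1; split => //; split => //.
  by rewrite invf_ge1// ltW.
Qed.

End levy_density.

(** * Integrals against the law of the subordinator *)

Section subordinator.
Context {R : realType} (m : R -> R).
Hypothesis m_ge0 : forall s, 0 < s -> 0 <= m s.
Hypothesis m_noninc : forall s s', 0 < s -> s <= s' -> m s' <= m s.
Hypothesis m_levy :
  (\int[@lebesgue_measure R]_(s in `]0%R, +oo[) (Num.min 1 s * m s)%:E < +oo)%E.
Implicit Types (P : probability R R) (t u : R).

Local Notation I := (wint (@lebesgue_measure R) `]0, +oo[ m).
Local Notation J P := (wint P (`]0, +oo[ : set R) (cst 1)).
Local Notation phi := (bern_phi m).

(** The Laplace transform includes the origin, where the law may have an atom, whereas [J P]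
    integrates over the open half line. *)
Definition subordinator_law t P := forall lam, 0 <= lam ->
  (\int[P]_(s in `[0%R, +oo[) (expR (- (lam * s)))%:E
    = (expR (- (t * bern_phi m lam)))%:E)%E.

Lemma probability_bounded_integrable P (B : R) (f : R -> R) :
  measurable_fun (`]0, +oo[ : set R) f -> (forall s, 0 < s -> `|f s| <= B) ->
  wintegrable P (`]0, +oo[ : set R) (cst 1) f.
Proof.
move=> mf fB.
refine (@le_wintegrable _ _ _ P _ _ _ _ B f (cst 1) mf _ _).
- exact: measurable_itv.
- exact: measurable_cst.
- rewrite /wintegrable (_ : EFin \o _ = EFin \o cst 1); last first.
    by apply/funext => s /=; rewrite mulr1.
  exact: finite_measure_integrable_cst.
- by move=> s /=; rewrite in_itv/= andbT mulr1 => /fB.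
Qed.

Lemma probability_tame_integrable P (f : R -> R) : tame f ->
  wintegrable P (`]0, +oo[ : set R) (cst 1) f.
Proof.
move=> [mf [C hC]].
apply: (@probability_bounded_integrable P `|C|) => // s s0.
rewrite (le_trans (hC _ s0))// (le_trans (ler_norm _))// normrM ler_piMr//.
by rewrite ger0_norm ?ge_min ?lexx// le_min ler01 ltW.
Qed.

Lemma probability_positive_functional P : positive_functional (J P).
Proof.
split=> [f g tf tg fg|f g tf tg|c f tf].
- apply: wint_le => //; try exact: probability_tame_integrable.
  by move=> s /=; rewrite in_itv/= andbT => /fg.
- by apply: wintD => //; exact: probability_tame_integrable.
- by apply: wintZ => //; exact: probability_tame_integrable.
Qed.

Lemma expRN_integrable P lam : 0 <= lam ->
  wintegrable P (`]0, +oo[ : set R) (cst 1) (fun s => expR (- (lam * s))).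
Proof.
move=> l0; apply: (@probability_bounded_integrable P 1).
  exact: measurable_expRN.
move=> s s0; rewrite ger0_norm ?expR_ge0// expR_le1 oppr_le0.
by rewrite mulr_ge0// ltW.
Qed.

(* [a] is the mass of the law at the origin. *)
Lemma subordinator_laplace t P : subordinator_law t P ->
  exists a : R, forall lam, 0 <= lam ->
    J P (fun s => expR (- (lam * s))) = expR (- (t * phi lam)) - a.
Proof.
move=> sub; exists (\int[P]_(s in [set 0]) 1) => lam l0.
apply/eqP; rewrite eq_sym subr_eq; apply/eqP.
have := sub lam l0 => /(congr1 fine) /= <-.
have E : `[0, +oo[%classic = [set 0] `|` `]0, +oo[%classic :> set R.
  by rewrite setU1itv.
rewrite -/(Rintegral P _ _) E Rintegral_setU//=; last 2 first.
- rewrite -E; apply: measurable_bounded_integrable => //.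
  + by rewrite (le_lt_trans (probability_le1 _ _))// ltry.
  + exact: measurable_expRN.
  + exists 1; split => // M M1 s /=; rewrite in_itv/= andbT => s0.
    rewrite ger0_norm ?expR_ge0// (le_trans _ (ltW M1))// expR_le1 oppr_le0.
    by rewrite mulr_ge0.
- apply/disj_setPS => s [/= ->]; by rewrite in_itv/= ltxx.
rewrite addrC; congr (_ + _).
  by apply: eq_Rintegral => s _; rewrite mulr1.
apply: eq_Rintegral => s; rewrite inE/= => ->.
by rewrite mulr0 oppr0 expR0.
Qed.

(** The coefficients of [ediff] sum to zero, so the mass at the origin cancels. *)
Lemma subordinator_ediff t P u : subordinator_law t P -> 0 <= u ->
  J P (fun s => ediff (u * s)) = expR (- (t * phi u)) - expR (- (t * phi (2 * u))).
Proof.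
move=> /subordinator_laplace[a ha] u0; have u2 : 0 <= 2 * u by rewrite mulr_ge0.
rewrite (_ : J P (fun s => ediff (u * s)) =
    J P (fun s => expR (- (u * s))) - J P (fun s => expR (- (2 * u * s)))).
  rewrite (ha _ u0) (ha _ u2).
  by rewrite opprB addrA subrK.
rewrite -wintB; [|exact: measurable_itv|exact: expRN_integrable..].
by apply: eq_wint => s _; rewrite /ediff mulrA.
Qed.

Lemma subordinator_ediff2 t P u : subordinator_law t P -> 0 <= u ->
  J P (fun s => ediff2 (u * s)) = expR (- (t * phi u))
    - 2 * expR (- (t * phi (2 * u))) + expR (- (t * phi (3 * u))).
Proof.
move=> /subordinator_laplace[a ha] u0; have u2 : 0 <= 2 * u by rewrite mulr_ge0.
have u3 : 0 <= 3 * u by rewrite mulr_ge0.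
have E (x y z : R) : x - a - 2 * (y - a) + (z - a) = x - 2 * y + z by ring.
rewrite (_ : J P (fun s => ediff2 (u * s)) =
    J P (fun s => expR (- (u * s))) - 2 * J P (fun s => expR (- (2 * u * s)))
    + J P (fun s => expR (- (3 * u * s)))).
  rewrite (ha _ u0) (ha _ u2) (ha _ u3).
  exact: E.
have i1 := expRN_integrable P _ u0; have i2 := expRN_integrable P _ u2.
have i3 := expRN_integrable P _ u3.
have i2' := wintegrableZ _ _ _ (measurable_itv _) 2 _ i2.
have mD : measurable (`]0, +oo[%classic : set R) by exact: measurable_itv.
rewrite -(wintZ _ _ _ mD 2 _ i2) -(wintB _ _ _ mD _ _ i1 i2').
rewrite -(wintD _ _ _ mD _ _ (wintegrableB _ _ _ mD _ _ i1 i2') i3).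
by apply: eq_wint => s _; rewrite /ediff2 !mulrA.
Qed.

(** Combine [e^-x <= 1 / (1 + x)] with [(1 + x)(1 - x + x^2) = 1 + x^3]. *)
Lemma expRN_quadratic_le (x : R) : 0 <= x -> expR (- x) <= 1 - x + x ^+ 2.
Proof.
move=> x0; have x1 : 0 < 1 + x by rewrite ltr_wpDr.
rewrite expRN; apply: (@le_trans _ _ (1 + x)^-1).
  by rewrite lef_pV2 ?posrE ?expR_gt0// expR_ge1Dx.
rewrite -div1r ler_pdivrMr//.
have : 0 <= x ^+ 3 by rewrite exprn_ge0.
by lra.
Qed.
Lemma subordinator_gker_ge d theta alpha cbar :
  0 <= theta -> 0 < alpha -> 1 <= cbar ->
  WUSC (bern_dphi m) (- alpha) theta cbar ->
  exists2 c : R, 0 < c & forall t P u, 0 < t -> subordinator_law t P ->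
    theta < u -> t * phi u <= 1 ->
    c * (t * (u * laplace_sm m u)) <= J P (fun s => gker d (u * s)).
Proof.
move=> th0 a0 c1 wusc.
have [c c0 h] := WUSC_functional_gker_ge _ m_ge0 m_noninc m_levy d _ _ _
  th0 a0 c1 wusc.
exists c => // t P u t0 sub thu tphi.
have u0 : 0 < u by exact: le_lt_trans thu.
apply: (h _ (probability_positive_functional P) t u t0 thu).
- rewrite (subordinator_ediff _ _ _ sub (ltW u0)).
  have u20 : 0 < 2 * u by rewrite mulr_gt0.
  have := bern_phiB_ge _ m_ge0 m_noninc m_levy _ _ u0 u20.
  have := laplace_sm_double _ m_ge0 m_noninc m_levy _ u0.
  have := bern_phi_double _ m_ge0 m_noninc m_levy _ (ltW u0).
  have uu : u <= 2 * u by rewrite ler_peMl ?ler1n// ltW.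
  have := bern_phi_nondecreasing _ m_ge0 m_noninc m_levy _ _ (ltW u0) uu.
  move: tphi; move: (phi u) (phi (2 * u)) (laplace_sm m u) (laplace_sm m (2 * u)).
  move=> x y k1 k2 tx xy yx k12; have -> : 2 * u - u = u by ring.
  move=> uk.
  (* This keeps [e^(-t phi(2u))] above [e^-2], the origin of the factor [expR 2] in the required
     bound. *)
  have ty : t * y <= 2.
    apply: le_trans (ler_wpM2l (ltW t0) yx) _.
    by rewrite mulrCA -[leRHS]mulr1 ler_pM2l.
  have d1 : t * (u * k1) <= 4 * (t * y - t * x).
    rewrite -mulrBr [leRHS]mulrCA ler_pM2l//.
    apply: le_trans (ler_wpM2l (ltW u0) k12) _.
    by rewrite mulrCA ler_pM2l.
  apply: le_trans d1 _; rewrite -mulrA ler_pM2l//.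
  (* At [s = 1] this is a mean value bound for the exponential between [t phi(u)] and
     [t phi(2u)]. *)
  have := expRN_diff_ge (t * x) (t * y) 1; rewrite !mulr1 mul1r => d2.
  apply: le_trans (ler_wpM2l (expR_ge0 2) d2).
  rewrite mulrCA ler_peMr//.
    by rewrite subr_ge0 ler_pM2l.
  by rewrite -expRD -[leLHS]expR0 ler_expR subr_ge0.
- move=> w w0; rewrite (subordinator_ediff _ _ _ sub (ltW w0)).
  have w20 : 0 < 2 * w by rewrite mulr_gt0.
  have := bern_phiB_le _ m_ge0 m_noninc m_levy _ _ w0 w20.
  have := bern_phi_ge0 _ m_ge0 _ (ltW w0).
  have w2 : w <= 2 * w by rewrite ler_peMl ?ler1n// ltW.
  have := bern_phi_nondecreasing _ m_ge0 m_noninc m_levy _ _ (ltW w0) w2.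
  move: (phi w) (phi (2 * w)) (laplace_sm m w) => x y k xy x0.
  have -> : 2 * w - w = w by ring.
  move=> hk; apply: (@le_trans _ _ (t * y - t * x)); last first.
    by rewrite -mulrBr ler_pM2l.
  have := expRN_diff_le (t * x) (t * y) 1; rewrite !mulr1 mul1r => d2.
  apply: le_trans d2 _; rewrite ler_piMr//.
    by rewrite subr_ge0 ler_pM2l.
  by rewrite expR_le1 oppr_le0 mulr_ge0// ltW.
Qed.

(** Expand the three exponentials: constants cancel and the linear terms form the Lévy integral. The
    term at [2u] has a negative coefficient and needs only [e^-x >= 1 - x], so no [phi(2u)^2]
    appears. *)
Lemma subordinator_ediff2_le t P u : 0 < t -> subordinator_law t P -> 0 <= u ->
  J P (fun s => ediff2 (u * s)) <= t * I (fun s => ediff2 (u * s))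
    + t ^+ 2 * (phi u ^+ 2 + phi (3 * u) ^+ 2).
Proof.
move=> t0 sub u0; rewrite (subordinator_ediff2 _ _ _ sub u0).
rewrite (levy_ediff2 _ m_ge0 m_noninc m_levy _ u0).
have u3 : 0 <= 3 * u by rewrite mulr_ge0.
have := bern_phi_ge0 _ m_ge0 _ u0; have := bern_phi_ge0 _ m_ge0 _ u3.
move: (phi u) (phi (2 * u)) (phi (3 * u)) => x y z z0 x0.
have tx0 : 0 <= t * x by rewrite mulr_ge0// ltW.
have tz0 : 0 <= t * z by rewrite mulr_ge0// ltW.
have := expRN_quadratic_le _ tx0; have := expRN_quadratic_le _ tz0.
have := expR_ge1Dx (- (t * y)).
move: (expR _) (expR _) (expR _) => ex ey ez.
by lra.
Qed.

(** One step of the recursion from [u/4] ([p3], [i2], [x'], [y']) to [u]. The constant [3C]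
    reproduces itself because [C + 4 (3C) / 6 = 3C]. *)
Lemma rescaling_step (C t T x y x' y' r p1 p2 p3 i1 i2 : R) :
  0 < C -> 0 < t -> 0 <= T -> 0 <= x -> 0 <= y -> x' <= x -> y' <= y ->
  p3 <= 3 * C * (t * i2 + T * (x' + y')) + r ->
  p2 <= t * i1 + T * (x + y) -> p1 <= C * p2 + 6^-1 * p3 -> i2 <= 4 * i1 ->
  p1 <= 3 * C * (t * i1 + T * (x + y)) + 6^-1 * r.
Proof.
move=> C0 t0 T0 x0 y0 xx yy h3 h2 h1 hi.
have a1 := ler_wpM2l (ltW C0) h2.
have a2 : C * (t * i2) <= C * (t * (4 * i1)) by rewrite !ler_pM2l.
have a3 : C * (T * (x' + y')) <= C * (T * (x + y)).
  by rewrite ler_pM2l// ler_wpM2l// lerD.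
have a4 : 0 <= C * (T * (x + y)) by rewrite !mulr_ge0 ?addr_ge0// ltW.
by lra.
Qed.

Lemma ler_geometric_tail (a b B : R) : 0 <= B ->
  (forall n : nat, a <= b + B / 6 ^+ n) -> a <= b.
Proof.
move=> B0 h; apply/ler_addgt0Pr => e e0.
pose n := (Num.trunc (B / e)).+1; apply: le_trans (h n) _; rewrite lerD2l.
rewrite ler_pdivrMr ?exprn_gt0// mulrC -ler_pdivrMr//.
apply: ltW; apply: lt_le_trans (truncnS_gt _) _.
by rewrite -natrX ler_nat ltnW// ltn_expl.
Qed.

(** Rescaling applies to [m] but not to [P], so the remainder at [u/4] is not absorbed at once.
    Iterating divides it by 6 each time, while the Lévy integrals grow by at most 4. *)
Lemma subordinator_gker_le d : (3 <= d)%N -> exists2 C : R, 0 < C &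
  forall t P u, 0 < t -> subordinator_law t P -> 0 < u ->
    J P (fun s => gker d (u * s)) <= C * (t * I (fun s => ediff2 (u * s))
      + t ^+ 2 * (phi u ^+ 2 + phi (3 * u) ^+ 2)).
Proof.
move=> d3; have [C C0 h] := @functional_gker_le R d d3.
exists (3 * C); first by rewrite mulr_gt0.
move=> t P u t0 sub u0.
have [B B1 hB] := @gker_le_min R d.
have B0 : 0 <= B by rewrite (le_trans ler01).
(* A bound on the Gaussian integral at every scale, which starts the iteration. *)
pose b := J P (cst B).
have b0 : 0 <= b by apply: wint_ge0.
have hb w : 0 < w -> J P (fun s => gker d (w * s)) <= b.
  move=> w0; apply: wint_le => //.
  - by apply: probability_tame_integrable; exact: tame_gker.
  - apply: (@probability_bounded_integrable P `|B|) => //.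
  - move=> s /=; rewrite in_itv/= andbT => s0.
    apply: le_trans (hB _ (mulr_gt0 w0 s0)) _.
    by rewrite ler_piMr// ge_min lexx.
apply: (ler_geometric_tail _ _ b b0) => n.
elim: n u u0 => [|n IH] u u0.
  rewrite expr0 divr1 (le_trans (hb _ u0))// lerDr.
  rewrite mulr_ge0 ?mulr_ge0 ?(ltW C0)// addr_ge0//.
    by rewrite mulr_ge0 ?(ltW t0)// (levy_ge0 _ m_ge0)// => s _; exact: ediff2_ge0.
  by rewrite (mulr_ge0 (sqr_ge0 _))// (addr_ge0 (sqr_ge0 _))// sqr_ge0.
have u40 : 0 < u / 4 by rewrite divr_gt0.
have E : (fun s => ediff2 (u / 4 * s)) = (fun s => ediff2 (u * (s / 4))).
  by apply/funext => s; rewrite mulrA mulrAC.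
have t4 : tame (fun s => ediff2 (u * (s / 4))).
  by rewrite -E; apply: tame_ediff2; exact: ltW.
have hi := levy_rescale _ m_ge0 m_noninc m_levy 4 (fun s => ediff2 (u * s))
  (ler1n _ 4) (tame_ediff2 _ (ltW u0)) t4 (fun s _ => ediff2_ge0 _).
rewrite -E in hi.
have h1 := h _ (probability_positive_functional P) u u0.
have h2 := subordinator_ediff2_le _ _ _ t0 sub (ltW u0).
have D1 : phi (u / 4) ^+ 2 <= phi u ^+ 2.
  rewrite lerXn2r ?nnegrE ?(bern_phi_ge0 _ m_ge0) ?(ltW u0) ?(ltW u40)//.
  apply: (bern_phi_nondecreasing _ m_ge0 m_noninc m_levy); first exact: ltW.
  by rewrite ler_pdivrMr// ler_peMr ?ler1n// ltW.
have D2 : phi (3 * (u / 4)) ^+ 2 <= phi (3 * u) ^+ 2.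
  have u30 : 0 <= 3 * (u / 4) by rewrite mulr_ge0// ltW.
  have u3 : 0 <= 3 * u by rewrite mulr_ge0// ltW.
  rewrite lerXn2r ?nnegrE ?(bern_phi_ge0 _ m_ge0)//.
  apply: (bern_phi_nondecreasing _ m_ge0 m_noninc m_levy) => //.
  by rewrite ler_pM2l// ler_pdivrMr// ler_peMr ?ler1n// ltW.
have -> : b / 6 ^+ n.+1 = 6^-1 * (b / 6 ^+ n) by rewrite exprS invfM mulrCA.
exact: (rescaling_step _ _ _ _ _ _ _ _ _ _ _ _ _ C0 t0 (sqr_ge0 t)
  (sqr_ge0 _) (sqr_ge0 _) D1 D2 (IH _ u40) h2 h1 hi).
Qed.

End subordinator.

(** * Brownian scaling, the change of variable [u = |x|^-2], and the small time limit *)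

Lemma gaussE {R : realType} d (s : R) (x : 'rV[R]_d) : 0 < s -> 0 < enorm x ->
  gauss s x = enorm x ^- d * gker d (enorm x ^- 2 * s).
Proof.
move=> s0; rewrite /gauss /gker; move: (enorm x) => r r0.
have p0 : 0 < 4 * pi :> R by rewrite mulr_gt0// pi_gt0.
have r2 : 0 < r ^+ 2 by rewrite exprn_gt0.
have -> : 4 * pi * s = r ^+ 2 * (4 * pi * (r ^- 2 * s)).
  by rewrite [RHS]mulrCA (mulVKf (lt0r_neq0 r2)).
rewrite powRM; [|exact: ltW|]; last first.
  by rewrite ltW// !mulr_gt0 ?pi_gt0 ?invr_gt0.
rewrite -mulrA; congr (_ * (_ * expR (- _))).
  rewrite -powR_mulrn ?ltW// -powRrM.
  have -> : 2%:R * - (d%:R / 2) = - d%:R :> R by field.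
  by rewrite powR_invn ?ltW.
by rewrite !invfM invrK mulrCA.
Qed.

Lemma enorm_surj {R : realType} d (r : R) : (0 < d)%N -> 0 <= r ->
  exists x : 'rV[R]_d, enorm x = r.
Proof.
case: d => // d _ r0; exists (\row_j (if j == ord0 then r else 0)).
rewrite /enorm big_ord_recl big1 => [|i _]; last by rewrite mxE/= expr0n.
by rewrite mxE eqxx addr0 sqrtr_sqr ger0_norm.
Qed.

Lemma enorm_inv_sqr_surj {R : realType} d (u : R) : (0 < d)%N -> 0 < u ->
  exists2 x : 'rV[R]_d, 0 < enorm x & enorm x ^- 2 = u.
Proof.
move=> d0 u0; have su0 : 0 < Num.sqrt u by rewrite sqrtr_gt0.
have [x xE] : exists x : 'rV[R]_d, enorm x = (Num.sqrt u)^-1.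
  by apply: enorm_surj; rewrite // invr_ge0 ltW.
exists x; rewrite xE; first by rewrite invr_gt0.
by rewrite -exprVn invrK sqr_sqrtr// ltW.
Qed.

Lemma ltr_inv_inv_sqr {R : realType} (theta r : R) : 0 < theta -> 0 < r ->
  (r < theta^-1) = (theta ^+ 2 < r ^- 2).
Proof.
move=> th0 r0; rewrite -exprVn ltr_pXn2r ?nnegrE ?invr_ge0 ?ltW//.
by rewrite -[theta in RHS]invrK ltf_pV2 ?posrE ?invr_gt0.
Qed.

(** After division by [t] the quadratic term is of order [t], and the constraint [t p <= 1] holds
    for all small [t]. *)
Lemma small_time_limit {R : realType} {C A p C' Q D : R} :
  0 <= p -> 0 < C' -> 0 <= D ->
  (forall t, 0 < t -> t * p <= 1 -> C * (t * A) <= C' * (t * Q + t ^+ 2 * D)) ->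
  C * A <= C' * Q.
Proof.
move=> p0 C'0 D0 h; apply/ler_addgt0Pr => e e0.
(* The first entry ensures [t p <= 1], the second makes the error at most [e]; adding 1 keeps both
   denominators positive. *)
pose t := Num.min (1 + p)^-1 (e / (C' * D + 1)).
have p1 : 0 < 1 + p by rewrite ltr_wpDr.
have D1 : 0 < C' * D + 1 by rewrite ltr_wpDl// mulr_ge0// ltW.
have t0 : 0 < t by rewrite lt_min invr_gt0 p1 divr_gt0.
have tp : t * p <= 1.
  apply: (@le_trans _ _ ((1 + p)^-1 * p)).
    by rewrite ler_wpM2r// ge_min lexx.
  by rewrite mulrC ler_pdivrMr// mul1r lerDr.
have te : t * (C' * D + 1) <= e.
  by rewrite -ler_pdivlMr// ge_min lexx orbT.
have := h t t0 tp.
have -> : C * (t * A) = t * (C * A) by ring.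
have -> : C' * (t * Q + t ^+ 2 * D) = t * (C' * Q + t * (C' * D)) by ring.
rewrite ler_pM2l// => /le_trans; apply.
by rewrite lerD2l (le_trans _ te)// ler_pM2l// lerDl.
Qed.

(** * The implications between the scaling and the two lower bounds *)

Section equivalence.
Context {R : realType} (d : nat) (m : R -> R) (eta : R -> probability R R).
Hypothesis d3 : (3 <= d)%N.
Hypothesis m_ge0 : forall s, 0 < s -> 0 <= m s.
Hypothesis m_noninc : forall s s', 0 < s -> s <= s' -> m s' <= m s.
Hypothesis m_levy :
  (\int[@lebesgue_measure R]_(s in `]0%R, +oo[) (Num.min 1 s * m s)%:E < +oo)%E.
Hypothesis eta_law : forall t, 0 < t -> subordinator_law m t (eta t).

Local Notation I := (wint (@lebesgue_measure R) `]0, +oo[ m).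
Local Notation J P := (wint P (`]0, +oo[ : set R) (cst 1)).

Lemma levy_nuE (x : 'rV[R]_d) : 0 < enorm x ->
  levy_nu m x = enorm x ^- d * I (fun s => gker d (enorm x ^- 2 * s)).
Proof.
move=> x0; have u0 : 0 < enorm x ^- 2 by rewrite invr_gt0 exprn_gt0.
rewrite -(levyZ _ m_ge0 m_noninc m_levy); last exact: tame_gker.
transitivity (I (fun s => gauss s x)); first by [].
by apply: eq_wint => s /=; rewrite in_itv/= andbT => s0; rewrite gaussE.
Qed.

Lemma sbm_densityE t (x : 'rV[R]_d) : 0 < enorm x ->
  sbm_density eta t x =
  enorm x ^- d * J (eta t) (fun s => gker d (enorm x ^- 2 * s)).
Proof.
move=> x0; have u0 : 0 < enorm x ^- 2 by rewrite invr_gt0 exprn_gt0.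
rewrite -(pf_scale _ (probability_positive_functional (eta t))); last first.
  exact: tame_gker.
apply: eq_Rintegral => s; rewrite inE/= in_itv/= andbT => s0.
by rewrite mulr1 gaussE.
Qed.

(** Both sides carry the factor [|x|^-d]; the remaining [|x|^-2] is [u]. *)
Lemma levy_bound_rescaled (C : R) (x : 'rV[R]_d) : 0 < enorm x ->
  (C * enorm x ^- (d + 2) * bern_dphi m (enorm x ^- 2) <= levy_nu m x) =
  (C * (enorm x ^- 2 * laplace_sm m (enorm x ^- 2))
     <= I (fun s => gker d (enorm x ^- 2 * s))).
Proof.
move=> x0; have u0 : 0 < enorm x ^- 2 by rewrite invr_gt0 exprn_gt0.
rewrite levy_nuE// (bern_dphiE _ m_ge0 m_noninc m_levy _ u0).
rewrite exprD invfM [C * _]mulrCA -!mulrA ler_pM2l//.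
by rewrite invr_gt0 exprn_gt0.
Qed.

Lemma sbm_bound_rescaled (C t : R) (x : 'rV[R]_d) : 0 < enorm x ->
  (C * t * enorm x ^- (d + 2) * bern_dphi m (enorm x ^- 2)
     <= sbm_density eta t x) =
  (C * (t * (enorm x ^- 2 * laplace_sm m (enorm x ^- 2)))
     <= J (eta t) (fun s => gker d (enorm x ^- 2 * s))).
Proof.
move=> x0; have u0 : 0 < enorm x ^- 2 by rewrite invr_gt0 exprn_gt0.
rewrite sbm_densityE// (bern_dphiE _ m_ge0 m_noninc m_levy _ u0).
rewrite exprD invfM [C * t * _]mulrCA -!mulrA ler_pM2l//.
by rewrite invr_gt0 exprn_gt0.
Qed.

(** The radius uses [1 + theta], which is positive even for [theta = 0] and satisfies
    [(1 + theta)^2 > theta]. *)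
Lemma WUSC_near_origin (theta : R) (x : 'rV[R]_d) : 0 <= theta ->
  0 < enorm x -> enorm x < (1 + theta)^-1 -> theta < enorm x ^- 2.
Proof.
move=> th0 x0; rewrite ltr_inv_inv_sqr ?ltr_wpDr//; apply: lt_trans.
by have := sqr_ge0 theta; lra.
Qed.

Lemma WUSC_sbm_density_ge theta alpha cbar :
  0 <= theta -> 0 < alpha -> 1 <= cbar ->
  WUSC (bern_dphi m) (- alpha) theta cbar ->
  exists C theta', 0 < C /\ 0 < theta' /\
    forall t (x : 'rV[R]_d), 0 < t -> t * bern_phi m (enorm x ^- 2) <= 1 ->
      0 < enorm x -> enorm x < theta'^-1 ->
      C * t * enorm x ^- (d + 2) * bern_dphi m (enorm x ^- 2)
        <= sbm_density eta t x.
Proof.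
move=> th0 a0 c1 wusc.
have [c c0 h] := subordinator_gker_ge _ m_ge0 m_noninc m_levy d _ _ _
  th0 a0 c1 wusc.
exists c, (1 + theta); split => //; split; first by rewrite ltr_wpDr.
move=> t x t0 tphi x0 xth; rewrite sbm_bound_rescaled//.
by apply: h => //; [exact: eta_law|exact: WUSC_near_origin].
Qed.

Lemma WUSC_levy_nu_ge theta alpha cbar :
  0 <= theta -> 0 < alpha -> 1 <= cbar ->
  WUSC (bern_dphi m) (- alpha) theta cbar ->
  exists C theta', 0 < C /\ 0 < theta' /\
    forall x : 'rV[R]_d, 0 < enorm x -> enorm x < theta'^-1 ->
      C * enorm x ^- (d + 2) * bern_dphi m (enorm x ^- 2) <= levy_nu m x.
Proof.
move=> th0 a0 c1 wusc.
have [c c0 h] := levy_nu_gker_ge _ m_ge0 m_noninc m_levy d _ _ _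
  th0 a0 c1 wusc.
exists c, (1 + theta); split => //; split; first by rewrite ltr_wpDr.
move=> x x0 xth; rewrite levy_bound_rescaled//.
by apply: h; exact: WUSC_near_origin.
Qed.

Lemma levy_nu_ge_WUSC (C theta : R) : 0 < C -> 0 < theta ->
  (forall x : 'rV[R]_d, 0 < enorm x -> enorm x < theta^-1 ->
    C * enorm x ^- (d + 2) * bern_dphi m (enorm x ^- 2) <= levy_nu m x) ->
  exists theta alpha cbar, 0 <= theta /\ 0 < alpha /\ 1 <= cbar /\
    WUSC (bern_dphi m) (- alpha) theta cbar.
Proof.
move=> C0 th0 hnu.
have [C' C'0 h] := levy_gker_le_ediff2 _ m_ge0 m_noninc m_levy _ d3.
have th20 : 0 <= theta ^+ 2 by exact: sqr_ge0.
(* In terms of [u = |x|^-2], the condition [|x| < theta^-1] reads [u > theta^2]. *)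
exists (theta ^+ 2).
have [||alpha [cbar [a0 [c1 wusc]]]] :=
  ediff2_WUSC _ m_ge0 m_noninc m_levy (theta ^+ 2) (C' / C) th20.
- by rewrite divr_gt0.
- move=> u thu; have u0 : 0 < u by exact: le_lt_trans thu.
  have [x x0 xu] := enorm_inv_sqr_surj d u (leq_trans (isT : 0 < 3)%N d3) u0.
  have := hnu x x0; rewrite ltr_inv_inv_sqr// levy_bound_rescaled// xu => hx.
  rewrite mulrAC ler_pdivlMr// mulrC.
  exact: le_trans (hx thu) (h _ u0).
- by exists alpha, cbar.
Qed.

Lemma sbm_density_ge_WUSC (C theta : R) : 0 < C -> 0 < theta ->
  (forall t (x : 'rV[R]_d), 0 < t -> t * bern_phi m (enorm x ^- 2) <= 1 ->
    0 < enorm x -> enorm x < theta^-1 ->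
    C * t * enorm x ^- (d + 2) * bern_dphi m (enorm x ^- 2)
      <= sbm_density eta t x) ->
  exists theta alpha cbar, 0 <= theta /\ 0 < alpha /\ 1 <= cbar /\
    WUSC (bern_dphi m) (- alpha) theta cbar.
Proof.
move=> C0 th0 hp.
have [C' C'0 h] := subordinator_gker_le _ m_ge0 m_noninc m_levy _ d3.
have th20 : 0 <= theta ^+ 2 by exact: sqr_ge0.
exists (theta ^+ 2).
have [||alpha [cbar [a0 [c1 wusc]]]] :=
  ediff2_WUSC _ m_ge0 m_noninc m_levy (theta ^+ 2) (C' / C) th20.
- by rewrite divr_gt0.
- move=> u thu; have u0 : 0 < u by exact: le_lt_trans thu.
  have [x x0 xu] := enorm_inv_sqr_surj d u (leq_trans (isT : 0 < 3)%N d3) u0.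
  rewrite mulrAC ler_pdivlMr// mulrC.
  (* With [u] fixed, letting [t] tend to 0 removes the squares of [phi] and leaves the Lévy integral
     of [ediff2]. *)
  apply: (small_time_limit (bern_phi_ge0 _ m_ge0 _ (ltW u0)) C'0
    (D := bern_phi m u ^+ 2 + bern_phi m (3 * u) ^+ 2)).
    by rewrite (addr_ge0 (sqr_ge0 _))// sqr_ge0.
  move=> t t0 tphi; have := hp t x t0.
  rewrite ltr_inv_inv_sqr// sbm_bound_rescaled// xu => /(_ tphi x0 thu) hx.
  exact: le_trans hx (h _ _ _ t0 (eta_law _ t0) u0).
- by exists alpha, cbar.
Qed.

End equivalence.

Theorem mainTheorem19 (R : realType) (d : nat) (m : R -> R)
    (eta : R -> probability R R) :
  (3 <= d)%N ->
  (* the Lévy measure of phi has a nonnegative, non-increasing density m *)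
  (forall s, 0 < s -> 0 <= m s) ->
  (forall s s', 0 < s -> s <= s' -> m s' <= m s) ->
  (\int[@lebesgue_measure R]_(s in `]0%R, +oo[) (Num.min 1 s * m s)%:E < +oo)%E ->
  (* eta t is the law of the subordinator T_t with Laplace exponent phi *)
  (forall t, 0 < t -> eta t `]-oo, 0%R[%classic = 0%E) ->
  (forall t lam, 0 < t -> 0 <= lam ->
     (\int[eta t]_(s in `[0%R, +oo[) (expR (- (lam * s)))%:E
       = (expR (- (t * bern_phi m lam)))%:E)%E) ->
  ((exists theta alpha cbar, 0 <= theta /\ 0 < alpha /\ 1 <= cbar /\
       WUSC (bern_dphi m) (- alpha) theta cbar)
   <->
   (exists C theta, 0 < C /\ 0 < theta /\
      forall t (x : 'rV[R]_d), 0 < t ->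
        t * bern_phi m ((enorm x)^-2) <= 1 ->
        0 < enorm x -> enorm x < theta^-1 ->
        C * t * (enorm x) ^- (d + 2)%N * bern_dphi m ((enorm x)^-2)
          <= sbm_density eta t x))
  /\
  ((exists C theta, 0 < C /\ 0 < theta /\
      forall t (x : 'rV[R]_d), 0 < t ->
        t * bern_phi m ((enorm x)^-2) <= 1 ->
        0 < enorm x -> enorm x < theta^-1 ->
        C * t * (enorm x) ^- (d + 2)%N * bern_dphi m ((enorm x)^-2)
          <= sbm_density eta t x)
   <->
   (exists C theta, 0 < C /\ 0 < theta /\
      forall x : 'rV[R]_d, 0 < enorm x -> enorm x < theta^-1 ->
        C * (enorm x) ^- (d + 2)%N * bern_dphi m ((enorm x)^-2)
          <= levy_nu m x)).

Proof.
move=> d3 m0 mdec mint _ lap.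
have law t : 0 < t -> subordinator_law m t (eta t) by move=> t0 lam; exact: lap.
have i_ii := WUSC_sbm_density_ge d m eta m0 mdec mint law.
have i_iii := WUSC_levy_nu_ge d m m0 mdec mint.
have ii_i := sbm_density_ge_WUSC d m eta d3 m0 mdec mint law.
have iii_i := levy_nu_ge_WUSC d m d3 m0 mdec mint.
split; split.
- by move=> [theta [alpha [cbar [th0 [a0 [c1 w]]]]]]; exact: i_ii w.
- by move=> [C [theta [C0 [th0 h]]]]; exact: ii_i C0 th0 h.
(* The two lower bounds are compared only through the scaling condition. *)
- move=> [C [theta [C0 [th0 h]]]].
  have [th [alpha [cbar [t0 [a0 [c1 w]]]]]] := ii_i _ _ C0 th0 h.
  exact: i_iii w.
- move=> [C [theta [C0 [th0 h]]]].
  have [th [alpha [cbar [t0 [a0 [c1 w]]]]]] := iii_i _ _ C0 th0 h.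
  exact: i_ii w.
Qed.
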